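(* Let $e_*\in\mathbb{N}$ be an index such that $V_{e_*}^X=V_*^X$ for every real $X$, where $V_*^X$ is the uniformly $\Pi^{1,X}_1$ set defined in the context, and let $\mathrm{HJ}_{e_*}(X)=X\oplus V_{e_*}^X$. Then for every real $X$, $$X<_{\mathrm T}\mathrm{HJ}_{e_*}(X).$$ Moreover, for every real $X$ the following dichotomy holds: (1) if $\omega_1^X=\omega_1^{\mathrm{CK}}$, then $\mathrm{HJ}_{e_*}(X)\equiv_{\mathrm T}X'$ and $\mathcal{O}\not\leq_{\mathrm T}\mathrm{HJ}_{e_*}(X)$; (2) if $\omega_1^X>\omega_1^{\mathrm{CK}}$, then $\mathrm{HJ}_{e_*}(X)\equiv_{\mathrm T}\mathcal{O}^X$ and $\mathcal{O}^{\mathcal{O}}\leq_{\mathrm T}\mathrm{HJ}_{e_*}(X)$. Consequently, $$\{\deg_{\mathrm T}(\mathrm{HJ}_{e_*}(X)):X\in 2^{\mathbb{N}}\}\cap\{\mathbf d:\deg_{\mathrm T}(\mathcal{O})\leq\mathbf d<\deg_{\mathrm T}(\mathcal{O}^{\mathcal{O}})\}=\varnothing.$$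
   Context: Reals are subsets of $\mathbb{N}$, identified with elements of $2^{\mathbb{N}}$. $\leq_{\mathrm T}$ is Turing reducibility, with $<_{\mathrm T}$ and $\equiv_{\mathrm T}$ the associated strict and equivalence relations; $\deg_{\mathrm T}(X)$ is the Turing degree of $X$; $X\oplus Y$ is the usual effective join; $X'$ is the Turing jump of $X$. The ordinal $\omega_1^X$ is the least ordinal which is not the order type of an $X$-recursive well-ordering, and $\omega_1^{\mathrm{CK}}=\omega_1^{\emptyset}$. For a real $X$, $\mathcal{O}^X$ is the relativized Kleene $\mathcal{O}$ (the hyperjump of $X$), which is $\Pi^{1,X}_1$-complete uniformly in $X$ (its Turing degree is that of the set of indices of $X$-recursive well-orderings); $\mathcal{O}=\mathcal{O}^{\emptyset}$, and $\mathcal{O}^{\mathcal{O}}$ is the hyperjump of $\mathcal{O}$. All analytical pointclasses are lightface, with oracle parameters indicated. Let $(V_e^X)_{e\in\mathbb{N}}$ be a standard effective enumeration, uniform in $X$, of the $\Pi^{1,X}_1$ subsets of $\mathbb{N}$; in particular, for every $\Pi^1_1$ predicate $Q(n,X)$ there is an $e$ such that $V_e^X=\{n:Q(n,X)\}$ for every real $X$. The pseudo-hyperjump operators are $\mathrm{HJ}_e(X)=X\oplus V_e^X$. Define, uniformly in $X$, the set $V_*^X\subseteq\mathbb{N}$ by: $2n\in V_*^X\iff n\in X'$; and $2n+1\in V_*^X\iff(\omega_1^X>\omega_1^{\mathrm{CK}}$ and $n\in\mathcal{O}^X)$. The predicate $\omega_1^X>\omega_1^{\mathrm{CK}}$ is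 a $\Pi^1_1$ predicate of $X$, so $V_*^X$ is uniformly $\Pi^{1,X}_1$ and an index $e_*$ with $V_{e_*}^X=V_*^X$ for every real $X$ exists; fix one. *)

(* Defs.v *)
From mathcomp Require Import all_boot.
From mathcomp Require Import boolp classical_sets functions.
From Stdlib Require Cantor.

Set Implicit Arguments.
Unset Strict Implicit.
Unset Printing Implicit Defensive.

Local Open Scope classical_set_scope.

(* Reals are sets of natural numbers, i.e. elements of [set nat]. *)

Definition pr (x y : nat) : nat := Cantor.to_nat (x, y).
Definition pr1 (n : nat) : nat := (Cantor.of_nat n).1.
Definition pr2 (n : nat) : nat := (Cantor.of_nat n).2.

(* Programs for unary partial functions; several arguments are passed through
   the Cantor pairing. *)
Inductive code : Type :=
| Zero | Succ | Left | Right | Oracle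
| Pair of code & code
| Comp of code & code
| Prec of code & code
| Mu of code.

(* [eval f c x y]: program [c] with oracle [f : nat -> nat] halts on input [x]
   with output [y]. *)
Fixpoint eval (f : nat -> nat) (c : code) (x y : nat) {struct c} : Prop :=
  match c with
  | Zero => y = 0
  | Succ => y = x.+1
  | Left => y = pr1 x
  | Right => y = pr2 x
  | Oracle => y = f x
  | Pair c d => exists u v, [/\ eval f c x u, eval f d x v & y = pr u v]
  | Comp c d => exists2 u, eval f d x u & eval f c u y
  | Prec c d =>
      (fix rec (n z : nat) {struct n} : Prop :=
         match n with
         | 0 => eval f c (pr1 x) z
         | m.+1 => exists2 w, rec m w & eval f d (pr (pr1 x) (pr m w)) z
         end) (pr2 x) y
  | Mu c => eval f c (pr x y) 0 /\
            forall k, k < y -> exists v, eval f c (pr x k) v.+1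
  end.

Fixpoint encode (c : code) : nat :=
  match c with
  | Zero => pr 0 0
  | Succ => pr 1 0
  | Left => pr 2 0
  | Right => pr 3 0
  | Oracle => pr 4 0
  | Pair c d => pr 5 (pr (encode c) (encode d))
  | Comp c d => pr 6 (pr (encode c) (encode d))
  | Prec c d => pr 7 (pr (encode c) (encode d))
  | Mu c => pr 8 (encode c)
  end.

(* The graph of the e-th partial function recursive in [f]; it is empty when
   [e] is not the number of a program. *)
Definition Phi (f : nat -> nat) (e x y : nat) : Prop :=
  exists2 c, encode c = e & eval f c x y.

Definition chi (X : set nat) (n : nat) : nat := `[< X n >].

Definition turing_le (X Y : set nat) : Prop :=
  exists e, forall n, Phi (chi Y) e n (chi X n).
Definition turing_lt (X Y : set nat) : Prop :=
  turing_le X Y /\ ~ turing_le Y X.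
Definition turing_eq (X Y : set nat) : Prop :=
  turing_le X Y /\ turing_le Y X.

Notation "X <=_T Y" := (turing_le X Y) (at level 70, no associativity).
Notation "X <_T Y" := (turing_lt X Y) (at level 70, no associativity).
Notation "X ==_T Y" := (turing_eq X Y) (at level 70, no associativity).

Definition join (X Y : set nat) : set nat :=
  [set n | if odd n then Y n./2 else X n./2].

Definition jump (X : set nat) : set nat :=
  [set e | exists y, Phi (chi X) e e y].

Definition deg (X : set nat) : set (set nat) := [set Y | Y ==_T X].

Definition degree : set (set (set nat)) := range deg.

Definition deg_le (d d' : set (set nat)) : Prop :=
  exists X Y, [/\ d X, d' Y & X <=_T Y].
Definition deg_lt (d d' : set (set nat)) : Prop := deg_le d d' /\ d <> d'.

(* A well-ordering is given by its non-strict order relation on a subset of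
   [nat], its field. All ordinals below are countable, so they are represented
   by well-orderings of this kind, up to isomorphism. *)
Definition field (R : nat -> nat -> Prop) : set nat := [set x | R x x].

Definition well_ordering (R : nat -> nat -> Prop) : Prop :=
  [/\ forall x y, R x y -> field R x /\ field R y,
      forall x y z, R x y -> R y z -> R x z,
      forall x y, R x y -> R y x -> x = y
    & forall A : set nat, A `<=` field R -> A !=set0 ->
        exists2 x, A x & forall y, A y -> R x y].

Definition same_type (R S : nat -> nat -> Prop) : Prop :=
  exists2 f : nat -> nat, set_bij (field R) (field S) f &
    forall x y, field R x -> field R y -> (R x y <-> S (f x) (f y)).

Definition below (S : nat -> nat -> Prop) (a : nat) : nat -> nat -> Prop :=
  fun x y => [/\ S x y, S x a, x <> a, S y a & y <> a].

Definition type_lt (R S : nat -> nat -> Prop) : Prop :=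
  exists2 a, field S a & same_type R (below S a).
Definition type_le (R S : nat -> nat -> Prop) : Prop :=
  type_lt R S \/ same_type R S.

Definition recursive_in (X : set nat) (R : nat -> nat -> Prop) : Prop :=
  [set n | R (pr1 n) (pr2 n)] <=_T X.

Definition recursive_type (X : set nat) (W : nat -> nat -> Prop) : Prop :=
  exists R, [/\ recursive_in X R, well_ordering R & same_type R W].

Definition is_omega1 (X : set nat) (W : nat -> nat -> Prop) : Prop :=
  [/\ well_ordering W,
      ~ recursive_type X W
    & forall S, well_ordering S -> ~ recursive_type X S -> type_le W S].

Definition omega1_eq (X Y : set nat) : Prop :=
  exists2 W, is_omega1 X W & is_omega1 Y W.
Definition omega1_lt (X Y : set nat) : Prop :=
  exists U W, [/\ is_omega1 X U, is_omega1 Y W & type_lt U W].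

(* The set of ordinal notations relative to [X] and its order a <_O b, with 1
   denoting 0, 2^a a successor and 3 * 5^e a limit. *)
Inductive kleeneO (X : set nat) : nat -> Prop :=
| kleeneO_zero : kleeneO X 1
| kleeneO_succ a : kleeneO X a -> kleeneO X (2 ^ a)
| kleeneO_lim e (g : nat -> nat) :
    (forall n, Phi (chi X) e n (g n)) ->
    (forall n, kleeneO X (g n)) ->
    (forall n, kleeneO_lt X (g n) (g n.+1)) ->
    kleeneO X (3 * 5 ^ e)
with kleeneO_lt (X : set nat) : nat -> nat -> Prop :=
| kleeneO_lt_succ a : kleeneO X a -> kleeneO_lt X a (2 ^ a)
| kleeneO_lt_lim e (g : nat -> nat) n :
    (forall n, Phi (chi X) e n (g n)) ->
    (forall n, kleeneO X (g n)) ->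
    (forall n, kleeneO_lt X (g n) (g n.+1)) ->
    kleeneO_lt X (g n) (3 * 5 ^ e)
| kleeneO_lt_trans a b c :
    kleeneO_lt X a b -> kleeneO_lt X b c -> kleeneO_lt X a c.

Definition hyperjump (X : set nat) : set nat := [set n | kleeneO X n].

Definition joinf (f g : nat -> nat) (n : nat) : nat :=
  if odd n then g n./2 else f n./2.

(* The enumeration of the Pi^1_1(X) sets given by Kleene's normal form
   "for all f in Baire space, exists k, R(n, X, f|k)" with R recursive: the
   matrix ranges over the predicates that are r.e. in the join of X and f. *)
Definition V (e : nat) (X : set nat) : set nat :=
  [set n | forall f : nat -> nat, exists y, Phi (joinf (chi X) f) e n y].

Definition HJ (e : nat) (X : set nat) : set nat := join X (V e X).

Definition Vstar (X : set nat) : set nat :=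
  join (jump X) [set n | omega1_lt set0 X /\ hyperjump X n].

(* Main.v *)
(* Two implications carry the theorem: O^O is recursive in O^X when
   omega_1^X > omega_1^CK, and omega_1^X > omega_1^CK when O is recursive in X'.

   Every Pi^1_1(X) set is { n : T_n is well-founded } for uniformly X-recursive
   trees T_n, and conversely well-foundedness of T_n reduces to membership in O^X.

   If omega_1^X > omega_1^CK, some X-recursive well-ordering W receives every
   recursive one. Then O, written as { n : T_n is well-founded } for recursive
   T_n, is determined by a Pi^0_1(X) condition on a function F: F gives a rank in
   W to each node of T_n when it declares n in O, and an infinite path of T_n when
   it declares n outside O. The ranks exist because the Kleene-Brouwer ordering of
   T_n is recursive. Hence n is in O^O iff n is in O^Z for every F that satisfies
   the condition, Z being the set of numbers that F declares in O. This is
   Pi^1_1(X), so O^O reduces to O^X.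

   If O is recursive in X', the set of indices of well-founded r.e. relations is
   Sigma_2(X). The finite descending sequences of those relations, each carrying a
   Sigma_2 witness that must not be refuted before the length of the sequence, form
   an X-recursive well-founded tree; all recursive well-orderings embed below the
   root in its Kleene-Brouwer ordering, so omega_1^X > omega_1^CK. *)

Require Import Defs.
From mathcomp Require Import all_boot.
From mathcomp Require Import boolp classical_sets functions.
From mathcomp Require Import zify.

Set Implicit Arguments.
Unset Strict Implicit.
Unset Printing Implicit Defensive.

Local Open Scope classical_set_scope.

Arguments pr : simpl never.
Arguments pr1 : simpl never.
Arguments pr2 : simpl never.

(** * Pairing, the numbering of programs and determinism of evaluation *)

Lemma pr1K x y : pr1 (pr x y) = x.
Proof. by rewrite /pr1 /pr Cantor.cancel_of_to. Qed.

Lemma pr2K x y : pr2 (pr x y) = y.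
Proof. by rewrite /pr2 /pr Cantor.cancel_of_to. Qed.

Lemma prK n : pr (pr1 n) (pr2 n) = n.
Proof.
by rewrite /pr /pr1 /pr2; case: (Cantor.of_nat n) (Cantor.cancel_to_of n).
Qed.

Definition prE := (pr1K, pr2K).

Lemma pr_inj x y x' y' : pr x y = pr x' y' -> x = x' /\ y = y'.
Proof.
by move=> E; split; [rewrite -(pr1K x y) E pr1K | rewrite -(pr2K x y) E pr2K].
Qed.

Lemma leq_pr1 x y : x <= pr x y.
Proof. have := Cantor.to_nat_non_decreasing x y; rewrite /pr; lia. Qed.

Lemma leq_pr2 x y : y <= pr x y.
Proof. have := Cantor.to_nat_non_decreasing x y; rewrite /pr; lia. Qed.

Lemma encode_inj : injective encode.
Proof.
elim=> [|||||c IHc d IHd|c IHc d IHd|c IHc d IHd|c IHc];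
  case=> [|||||c' d'|c' d'|c' d'|c'] //= /pr_inj [] //.
- by move=> _ /pr_inj [/IHc -> /IHd ->].
- by move=> _ /pr_inj [/IHc -> /IHd ->].
- by move=> _ /pr_inj [/IHc -> /IHd ->].
- by move=> _ /IHc ->.
Qed.

Lemma eval_fun f c x y y' : eval f c x y -> eval f c x y' -> y = y'.
Proof.
elim: c x y y' => [|||||c IHc d IHd|c IHc d IHd|c IHc d IHd|c IHc] x y y' /=;
  try by move=> -> ->.
- move=> [u [v [cu dv ->]]] [u' [v' [cu' dv' ->]]].
  by rewrite (IHc _ _ _ cu cu') (IHd _ _ _ dv dv').
- move=> [u du cu] [u' du' cu'].
  by rewrite (IHd _ _ _ du du') in cu; apply: IHc cu cu'.
- elim: (pr2 x) y y' => [|m IHm] y y' /=; first exact: IHc.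
  move=> [w Hw Hd] [w' Hw' Hd'].
  by rewrite (IHm _ _ Hw Hw') in Hd; apply: IHd Hd Hd'.
- move=> [y0 ylt] [y'0 y'lt]; case: (ltngtP y y') => // lt.
  + by have [v /(IHc _ _ _ y0)] := y'lt _ lt.
  + by have [v /(IHc _ _ _ y'0)] := ylt _ lt.
Qed.

Lemma PhiE f c x y : Phi f (encode c) x y <-> eval f c x y.
Proof.
split; last by exists c.
by move=> [d /encode_inj ->].
Qed.

Lemma Phi_fun f e x y y' : Phi f e x y -> Phi f e x y' -> y = y'.
Proof. by move=> [c <-] Hy /PhiE; apply: eval_fun. Qed.

(** * Computable functionals *)

(* The class [A] of admissible oracles makes the two uses uniform: all oracles
   for functionals, a single one for functions recursive in a real. *)
Definition computes (A : (nat -> nat) -> Prop) (F : (nat -> nat) -> nat -> nat) :=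
  exists c, forall f, A f -> forall x, eval f c x (F f x).

Section Closure.
Variable A : (nat -> nat) -> Prop.
Implicit Types F G : (nat -> nat) -> nat -> nat.
Implicit Types P Q : (nat -> nat) -> nat -> bool.

Lemma computes_ext F G : (forall f, A f -> forall x, F f x = G f x) ->
  computes A F -> computes A G.
Proof. by move=> FG [c cP]; exists c => f Af x; rewrite -FG //; apply: cP. Qed.

Lemma computes_id : computes A (fun _ x => x).
Proof. by exists (Pair Left Right) => f _ x /=; exists (pr1 x), (pr2 x); rewrite prK. Qed.

Lemma computes_comp F G : computes A F -> computes A G ->
  computes A (fun f x => F f (G f x)).
Proof.
move=> [c cP] [d dP]; exists (Comp c d) => f Af x /=.
by exists (G f x); [apply: dP | apply: cP].
Qed.

Lemma computes_pr1 F : computes A F -> computes A (fun f x => pr1 (F f x)).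
Proof. by move=> hF; apply: (@computes_comp (fun _ => pr1)) => //; exists Left. Qed.

Lemma computes_pr2 F : computes A F -> computes A (fun f x => pr2 (F f x)).
Proof. by move=> hF; apply: (@computes_comp (fun _ => pr2)) => //; exists Right. Qed.

Lemma computes_succ F : computes A F -> computes A (fun f x => (F f x).+1).
Proof. by move=> hF; apply: (@computes_comp (fun _ => S)) => //; exists Succ. Qed.

Lemma computes_oracle F : computes A F -> computes A (fun f x => f (F f x)).
Proof. by move=> hF; apply: (@computes_comp (fun f => f)) => //; exists Oracle. Qed.

Lemma computes_pr F G : computes A F -> computes A G ->
  computes A (fun f x => pr (F f x) (G f x)).
Proof.
move=> [c cP] [d dP]; exists (Pair c d) => f Af x /=.
by exists (F f x), (G f x); split; [apply: cP | apply: dP | ].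
Qed.

Lemma computes_const n : computes A (fun _ _ => n).
Proof.
elim: n => [|n IH]; first by exists Zero.
exact: (@computes_succ (fun _ _ => n)).
Qed.

Lemma computes_iteri N S B : computes A N ->
  computes A (fun f z => S f (pr1 z) (pr1 (pr2 z)) (pr2 (pr2 z))) ->
  computes A B ->
  computes A (fun f x => iteri (N f x) (S f x) (B f x)).
Proof.
move=> hN [s sP] [b bP].
(* [Prec] offers its step a single parameter, so the whole input is duplicated: it serves as that
   parameter, next to the counter [N f x]. *)
have hI : computes A (fun f z => iteri (pr2 z) (S f (pr1 z)) (B f (pr1 z))).
  exists (Prec b s) => f Af x /=.
  elim: (pr2 x) => [|m IHm] /=; first exact: bP.
  eexists; first exact: IHm.
  by have := sP f Af (pr (pr1 x) (pr m (iteri m (S f (pr1 x)) (B f (pr1 x))))); rewrite !prE.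
apply: computes_ext (computes_comp hI (computes_pr computes_id hN)) => f _ x.
by rewrite !prE.
Qed.

Lemma computes_iter N (S : (nat -> nat) -> nat -> nat -> nat) B : computes A N ->
  computes A (fun f z => S f (pr1 z) (pr2 z)) ->
  computes A B ->
  computes A (fun f x => iter (N f x) (S f x) (B f x)).
Proof.
move=> hN hS hB.
have hS' : computes A (fun f z => S f (pr1 z) (pr2 (pr2 z))).
  apply: computes_ext (computes_comp hS (computes_pr (computes_pr1 computes_id)
    (computes_pr2 (computes_pr2 computes_id)))) => f _ x.
  by rewrite !prE.
apply: computes_ext (@computes_iteri N (fun f x _ => S f x) B hN hS' hB) => f _ x.
by elim: (N f x) => //= n ->.
Qed.

Lemma computes_addn F G : computes A F -> computes A G ->
  computes A (fun f x => F f x + G f x).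
Proof.
move=> hF hG; apply: computes_ext (@computes_iter F (fun _ _ => S) G hF _ hG).
  by move=> f _ x; rewrite iter_succn addnC.
exact/computes_succ/computes_pr2/computes_id.
Qed.

Lemma computes_predn F : computes A F -> computes A (fun f x => (F f x).-1).
Proof.
move=> hF; apply: computes_ext (@computes_iteri F (fun _ _ m _ => m) (fun _ _ => 0) hF _ _).
- by move=> f _ x; case: (F f x).
- exact/computes_pr1/computes_pr2/computes_id.
- exact: computes_const.
Qed.

Lemma computes_subn F G : computes A F -> computes A G ->
  computes A (fun f x => F f x - G f x).
Proof.
move=> hF hG; apply: computes_ext (@computes_iter G (fun _ _ => predn) F hG _ hF).
  by move=> f _ x; rewrite iter_predn.
exact/computes_predn/computes_pr2/computes_id.
Qed.

Lemma computes_muln F G : computes A F -> computes A G ->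
  computes A (fun f x => F f x * G f x).
Proof.
move=> hF hG.
apply: computes_ext (@computes_iter F (fun f x => addn (G f x)) (fun _ _ => 0) hF _ _).
- by move=> f _ x; rewrite iter_addn addn0 mulnC.
- apply: computes_addn; last exact/computes_pr2/computes_id.
  exact/computes_comp/computes_pr1/computes_id.
- exact: computes_const.
Qed.

Lemma computes_expn F G : computes A F -> computes A G ->
  computes A (fun f x => F f x ^ G f x).
Proof.
move=> hF hG.
apply: computes_ext (@computes_iter G (fun f x => muln (F f x)) (fun _ _ => 1) hG _ _).
- by move=> f _ x; rewrite iter_muln muln1.
- apply: computes_muln; last exact/computes_pr2/computes_id.
  exact/computes_comp/computes_pr1/computes_id.
- exact: computes_const.
Qed.

(** The test is coerced to 0 or 1, so the conditional is an iteration of that length, starting from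
    [G], whose only possible step overwrites the value by [F]. *)
Lemma computes_if P F G : computes A P -> computes A F -> computes A G ->
  computes A (fun f x => if P f x then F f x else G f x).
Proof.
move=> hP hF hG.
apply: computes_ext (@computes_iter P (fun f x _ => F f x) G hP _ hG).
  by move=> f _ x; case: (P f x).
exact/computes_comp/computes_pr1/computes_id.
Qed.

Lemma computes_ifb P Q Q' : computes A P -> computes A Q -> computes A Q' ->
  computes A (fun f x => if P f x then Q f x else Q' f x : bool).
Proof.
move=> hP hQ hQ'; apply: computes_ext (computes_if hP hQ hQ') => f _ x.
by case: (P f x).
Qed.

Lemma computes_eq0 F : computes A F -> computes A (fun f x => F f x == 0).
Proof.
move=> hF; apply: computes_ext (computes_subn (computes_const 1) hF) => f _ x.
by case: (F f x).
Qed.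

Lemma computes_leq F G : computes A F -> computes A G ->
  computes A (fun f x => F f x <= G f x).
Proof. by move=> hF hG; apply/computes_eq0/computes_subn. Qed.

Lemma computes_and P Q : computes A P -> computes A Q ->
  computes A (fun f x => P f x && Q f x).
Proof.
move=> hP hQ; apply: computes_ext (computes_muln hP hQ) => f _ x.
by rewrite mulnb.
Qed.

Lemma computes_not P : computes A P -> computes A (fun f x => ~~ P f x).
Proof.
move=> hP; apply: computes_ext (computes_eq0 hP) => f _ x.
by case: (P f x).
Qed.

Lemma computes_or P Q : computes A P -> computes A Q ->
  computes A (fun f x => P f x || Q f x).
Proof.
move=> hP hQ.
apply: computes_ext (computes_not (computes_and (computes_not hP) (computes_not hQ))) => f _ x.
by rewrite negb_and !negbK.
Qed.

Lemma computes_implb P Q : computes A P -> computes A Q ->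
  computes A (fun f x => P f x ==> Q f x).
Proof.
move=> hP hQ; apply: computes_ext (computes_or (computes_not hP) hQ) => f _ x.
by rewrite implybE.
Qed.

Lemma computes_eqn F G : computes A F -> computes A G ->
  computes A (fun f x => F f x == G f x).
Proof.
move=> hF hG; apply: computes_ext (computes_and (computes_leq hF hG) (computes_leq hG hF)).
by move=> f _ x; rewrite eqn_leq.
Qed.

Lemma computes_find N (P : (nat -> nat) -> nat -> nat -> bool) : computes A N ->
  computes A (fun f z => P f (pr1 z) (pr2 z)) ->
  computes A (fun f x => find (P f x) (iota 0 (N f x))).
Proof.
move=> hN hP.
(* After [i] steps the accumulator equals [i] exactly when no witness has been found; a smaller
   value is the first witness and is kept. *)
pose S f x i w := if w < i then w else if P f x i then i else i.+1.
have hS : computes A (fun f z => S f (pr1 z) (pr1 (pr2 z)) (pr2 (pr2 z))).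
  have h1 := computes_pr1 (computes_pr2 computes_id).
  have h2 := computes_pr2 (computes_pr2 computes_id).
  apply: computes_if => //; first exact/computes_leq/h1/computes_succ.
  apply: computes_if => //; last exact: computes_succ.
  apply: computes_ext (computes_comp hP (computes_pr (computes_pr1 computes_id) h1)) => f _ x.
  by rewrite !prE.
apply: computes_ext (@computes_iteri N S (fun _ _ => 0) hN hS (computes_const 0)) => f _ x.
elim: (N f x) => [//|n IH].
rewrite -[in RHS]addn1 iotaD find_cat has_find size_iota add0n /= IH /S.
by case: ifP => // _; case: ifP; rewrite ?addn0 ?addn1.
Qed.

Lemma computes_all N (P : (nat -> nat) -> nat -> nat -> bool) : computes A N ->
  computes A (fun f z => P f (pr1 z) (pr2 z)) ->
  computes A (fun f x => all (P f x) (iota 0 (N f x))).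
Proof.
move=> hN hP.
have hF := @computes_find N (fun f x i => ~~ P f x i) hN (computes_not hP).
apply: computes_ext (computes_leq hN hF) => f _ x.
by rewrite -[all _ _]negbK -has_predC has_find size_iota -leqNgt.
Qed.

Lemma computes_has N (P : (nat -> nat) -> nat -> nat -> bool) : computes A N ->
  computes A (fun f z => P f (pr1 z) (pr2 z)) ->
  computes A (fun f x => has (P f x) (iota 0 (N f x))).
Proof.
move=> hN hP.
apply: computes_ext (computes_leq (computes_succ (computes_find hN hP)) hN) => f _ x.
by rewrite has_find size_iota.
Qed.

End Closure.

Lemma computes_sub (A B : (nat -> nat) -> Prop) F :
  (forall f, B f -> A f) -> computes A F -> computes B F.
Proof. by move=> BA [c cP]; exists c => f /BA; apply: cP. Qed.

(** Facts in the context are tried before decomposition by the head symbol. Later redefinitions of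
    [computes_tac] extend the same loop with further closure lemmas. *)
Ltac computes_step :=
  first
  [ assumption
  | match goal with
    | H : computes _ ?F |- computes _ (fun f x => ?F f (@?a f x)) =>
        apply: (computes_comp H)
    | H : computes _ (fun _ => ?g) |- computes _ (fun f x => ?g (@?a f x)) =>
        apply: (computes_comp H)
    end
  | lazymatch goal with
    | |- computes _ (fun _ _ => ?n) => exact: computes_const
    | |- computes _ (fun _ x => x) => apply: computes_id
    | |- computes _ (fun _ _ => pr1 _) => apply: computes_pr1
    | |- computes _ (fun _ _ => pr2 _) => apply: computes_pr2
    | |- computes _ (fun _ _ => pr _ _) => apply: computes_pr
    | |- computes _ (fun _ _ => if _ then _ else _) => apply: computes_if
    | |- computes _ (fun _ _ => nat_of_bool (if _ then _ else _)) =>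
        apply: computes_ifb
    | |- computes _ (fun _ _ => nat_of_bool (_ && _)) => apply: computes_and
    | |- computes _ (fun _ _ => nat_of_bool (_ || _)) => apply: computes_or
    | |- computes _ (fun _ _ => nat_of_bool (_ ==> _)) => apply: computes_implb
    | |- computes _ (fun _ _ => nat_of_bool (~~ _)) => apply: computes_not
    | |- computes _ (fun _ _ => nat_of_bool (_ == _)) => apply: computes_eqn
    | |- computes _ (fun _ _ => nat_of_bool (_ <= _)) => apply: computes_leq
    | |- computes _ (fun _ _ => nat_of_bool (all _ _)) => apply: computes_all
    | |- computes _ (fun _ _ => nat_of_bool (has _ _)) => apply: computes_has
    | |- computes _ (fun _ _ => find _ _) => apply: computes_find
    | |- computes _ (fun _ _ => _ + _) => apply: computes_addn
    | |- computes _ (fun _ _ => _ - _) => apply: computes_subn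
    | |- computes _ (fun _ _ => _ * _) => apply: computes_muln
    | |- computes _ (fun _ _ => _ ^ _) => apply: computes_expn
    | |- computes _ (fun _ _ => iteri _ _ _) => apply: computes_iteri
    | |- computes _ (fun _ _ => iter _ _ _) => apply: computes_iter
    | |- computes _ (fun _ _ => predn _) => apply: computes_predn
    | |- computes _ (fun f _ => f _) => apply: computes_oracle
    | |- computes _ (fun _ _ => S _) => apply: computes_succ
    end ].

Ltac computes_tac := cbv beta; repeat computes_step.

Lemma computes2 A (R : (nat -> nat) -> nat -> nat -> nat) F G :
  computes A (fun f z => R f (pr1 z) (pr2 z)) -> computes A F -> computes A G ->
  computes A (fun f x => R f (F f x) (G f x)).
Proof.
move=> hR hF hG; apply: computes_ext (computes_comp hR (computes_pr hF hG)) => f _ x.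
by rewrite !prE.
Qed.

Lemma computes3 A (R : (nat -> nat) -> nat -> nat -> nat -> nat) F G H :
  computes A (fun f z => R f (pr1 z) (pr1 (pr2 z)) (pr2 (pr2 z))) ->
  computes A F -> computes A G -> computes A H ->
  computes A (fun f x => R f (F f x) (G f x) (H f x)).
Proof.
move=> hR hF hG hH.
apply: computes_ext (computes_comp hR (computes_pr hF (computes_pr hG hH))) => f _ x.
by rewrite !prE.
Qed.

Lemma eval_pair f c d x u v :
  eval f c x u -> eval f d x v -> eval f (Pair c d) x (pr u v).
Proof. by move=> cu dv; exists u, v. Qed.

Lemma eval_comp f c d x u y : eval f d x u -> eval f c u y -> eval f (Comp c d) x y.
Proof. by move=> du cy; exists u. Qed.

(** The program [c] with its oracle simulated by [d]. A parameter for [d] travels in the left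
    component of every input; the instructions act on the right component, and [Prec] and [Mu],
    which append counters on the right, regroup their pairs. *)
Fixpoint subst (d c : code) : code :=
  match c with
  | Zero => Zero
  | Succ => Comp Succ Right
  | Left => Comp Left Right
  | Right => Comp Right Right
  | Oracle => d
  | Pair c1 c2 => Pair (subst d c1) (subst d c2)
  | Comp c1 c2 => Comp (subst d c1) (Pair Left (subst d c2))
  | Prec c1 c2 =>
      Comp (Prec (subst d c1)
              (Comp (subst d c2)
                 (Pair (Comp Left Left) (Pair (Comp Right Left) Right))))
        (Pair (Pair Left (Comp Left Right)) (Comp Right Right))
  | Mu c1 =>
      Mu (Comp (subst d c1) (Pair (Comp Left Left) (Pair (Comp Right Left) Right)))
  end.

Lemma eval_subst f (G : nat -> nat -> nat) d :
  (forall p q, eval f d (pr p q) (G p q)) ->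
  forall c p x y, eval (G p) c x y -> eval f (subst d c) (pr p x) y.
Proof.
move=> dP.
have shift p x y : eval f (Pair (Comp Left Left) (Pair (Comp Right Left) Right))
    (pr (pr p x) y) (pr p (pr x y)).
  apply: eval_pair; first by apply: eval_comp => //=; rewrite !prE.
  by apply: eval_pair => /=; rewrite ?prE //; exists (pr p x); rewrite ?prE.
elim=> [|||||c IHc e IHe|c IHc e IHe|c IHc e IHe|c IHc] p x y /=.
- by [].
- by move=> ->; exists x; rewrite ?prE.
- by move=> ->; exists x; rewrite ?prE.
- by move=> ->; exists x; rewrite ?prE.
- by move=> ->; apply: dP.
- move=> [u [v [/IHc cu /IHe ev ->]]]; exists u, v; split=> //.
- move=> [u /IHe eu /IHc cy]; exists (pr p u) => //.
  by apply: (@eval_pair f Left (subst d e)) => //=; rewrite prE.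
- move=> H; exists (pr (pr p (pr1 x)) (pr2 x)).
    apply: (@eval_pair f (Pair Left (Comp Left Right)) (Comp Right Right)) => /=.
      exists p, (pr1 x); split=> //; first by rewrite prE.
      by exists x; rewrite ?prE.
    by exists x; rewrite ?prE.
  rewrite !prE.
  elim: (pr2 x) y H => [|m IHm] y /=; first exact: IHc.
  move=> [w Hw Hy]; exists w; first exact: IHm.
  by exists (pr p (pr (pr1 x) (pr m w))); [exact: shift | exact: IHe].
- move=> [y0 ylt]; split; first by exists (pr p (pr x y)); [exact: shift | exact: IHc].
  move=> k /ylt [v cv]; exists v.
  by exists (pr p (pr x k)); [exact: shift | exact: IHc].
Qed.

(** The simulated oracle may depend on part of the input, so the universal function can be run with
    a coded finite sequence or a finite-stage approximation as its oracle. *)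
Lemma computes_subst (A B : (nat -> nat) -> Prop) H
    (G : (nat -> nat) -> nat -> nat -> nat) P N :
  computes B H -> (forall f, A f -> forall p, B (G f p)) ->
  computes A (fun f z => G f (pr1 z) (pr2 z)) ->
  computes A P -> computes A N ->
  computes A (fun f x => H (G f (P f x)) (N f x)).
Proof.
move=> [c cP] AB [d dP] hP hN.
have hH : computes A (fun f z => H (G f (pr1 z)) (pr2 z)).
  exists (subst d c) => f Af x; rewrite -{1}(prK x).
  apply: (@eval_subst f (G f)) => [p q|]; last exact/cP/AB.
  by have := dP f Af (pr p q); rewrite !prE.
exact: (computes2 (R := fun f p n => H (G f p) n)).
Qed.

(** As [P] is decided by a total program, [Mu] applied to its negation halts exactly when a witness
    exists; leastness of the witness gives the nonzero values that [Mu] demands below it. *)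
Lemma search_code A (P : (nat -> nat) -> nat -> nat -> bool) :
  computes A (fun f z => P f (pr1 z) (pr2 z)) ->
  exists c, forall f, A f -> forall x,
    (exists y, eval f c x y) <-> exists y, P f x y.
Proof.
move=> hP; have [c cP] := computes_not hP.
exists (Mu c) => f Af x; split=> [[y [y0 _]]|[y Pxy]].
  exists y; have := cP f Af (pr x y); rewrite !prE => /(eval_fun y0).
  by case: (P f x y).
have [z Pz zmin] : exists2 z, P f x z & forall k, k < z -> ~~ P f x k.
  case: (ex_minnP (ex_intro (fun y => P f x y) y Pxy)) => z Pz zmin; exists z => // k.
  by apply: contraTN => /zmin; rewrite leqNgt.
exists z; split; first by have := cP f Af (pr x z); rewrite !prE Pz.
move=> k /zmin NP; exists 0.
by have := cP f Af (pr x k); rewrite !prE NP.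
Qed.

(** * Finite sequences *)

(** The successor reserves 0 for the empty sequence, so that every number codes exactly one
    sequence. *)
Definition enc (s : seq nat) : nat := foldl (fun n k => (pr n k).+1) 0 s.
Arguments enc : simpl never.

(** The first argument is fuel: a proper prefix has a smaller code, so [n] itself is enough for
    [n]. *)
Fixpoint dec_rec (m n : nat) : seq nat :=
  if m is m'.+1 then
    if n is n'.+1 then rcons (dec_rec m' (pr1 n')) (pr2 n') else [::]
  else [::].
Definition dec (n : nat) : seq nat := dec_rec n n.

Lemma enc_rcons s k : enc (rcons s k) = (pr (enc s) k).+1.
Proof. by rewrite /enc foldl_rcons. Qed.

Lemma decK n : enc (dec n) = n.
Proof.
rewrite /dec; move: {2 3}n (leqnn n) => m.
elim: m n => [|m IH] [|n] //= le; rewrite ?ltnS in le.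
by rewrite enc_rcons IH ?prK //; have := leq_pr1 (pr1 n) (pr2 n); rewrite prK; lia.
Qed.

Lemma enc_inj : injective enc.
Proof.
elim/last_ind=> [|s k IH] t; case/lastP: t => [|t l] //; rewrite !enc_rcons //.
by case=> /pr_inj [/IH -> ->].
Qed.

Lemma encK s : dec (enc s) = s.
Proof. by apply: enc_inj; rewrite decK. Qed.

Lemma size_enc s : size s <= enc s.
Proof.
elim/last_ind: s => // s k IH; rewrite size_rcons enc_rcons ltnS.
exact: leq_trans (leq_pr1 _ _).
Qed.

Definition slen (n : nat) : nat := size (dec n).
Definition lk (n i : nat) : nat := nth 0 (dec n) i.

(** The map [pr1 n.-1] drops the last entry and fixes the code 0 of the empty sequence, since
    [pr1 0] is 0. Length and lookup become iterations of it. *)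
Lemma iter_pop j s : iter j (fun n => pr1 n.-1) (enc s) = enc (take (size s - j) s).
Proof.
elim: j => [|j IH] /=; first by rewrite subn0 take_size.
rewrite IH subnS; case E: (size s - j) => [|m] /=.
  by rewrite take0 /enc /=; have := leq_pr1 (pr1 0) (pr2 0); rewrite prK; lia.
by rewrite (take_nth 0) ?enc_rcons /= ?prE //; lia.
Qed.

Section ClosureSeq.
Variable A : (nat -> nat) -> Prop.
Implicit Types F G : (nat -> nat) -> nat -> nat.

Lemma computes_slen F : computes A F -> computes A (fun f x => slen (F f x)).
Proof.
move=> hF.
have : computes A (fun f x =>
    find (fun j => iter j (fun n => pr1 n.-1) (F f x) == 0) (iota 0 (F f x).+1)).
  apply: computes_find; first exact: computes_succ.
  apply: computes_eq0; apply: computes_iter; computes_tac.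
apply: computes_ext => f _ x.
set n := F f x; rewrite /slen -{1 2}(decK n); move: (dec n) => s.
have P j : (iter j (fun n => pr1 n.-1) (enc s) == 0) = (size s <= j).
  rewrite iter_pop -subn_eq0; case: (size s - j) (leq_subr j (size s)) => [|m] le.
    by rewrite take0.
  by rewrite (take_nth 0) // enc_rcons.
have E : iota 0 (enc s).+1 = iota 0 (size s) ++ size s :: iota (size s).+1 (enc s - size s).
  by rewrite -[RHS]/(iota 0 (size s) ++ iota (0 + size s) (enc s - size s).+1) -iotaD;
     congr iota; have := size_enc s; lia.
rewrite (eq_find P) E find_cat /= leqnn addn0 size_iota.
case: ifP => // /hasP [j]; rewrite mem_iota; lia.
Qed.

Lemma computes_lk F G : computes A F -> computes A G ->
  computes A (fun f x => lk (F f x) (G f x)).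
Proof.
move=> hF hG; have hs := computes_slen hF.
have : computes A (fun f x => if G f x < slen (F f x) then
    pr2 (iter (slen (F f x) - (G f x).+1) (fun n => pr1 n.-1) (F f x)).-1 else 0).
  by computes_tac.
apply: computes_ext => f _ x.
set n := F f x; rewrite /slen /lk -{3}(decK n); move: (dec n) => s.
case: ltnP => lt; last by rewrite nth_default.
rewrite iter_pop; have -> : size s - (size s - (G f x).+1) = (G f x).+1 by lia.
by rewrite (take_nth 0) // enc_rcons /= prE.
Qed.

Lemma computes_enc_mkseq (F : (nat -> nat) -> nat -> nat -> nat) N :
  computes A N -> computes A (fun f z => F f (pr1 z) (pr2 z)) ->
  computes A (fun f x => enc (mkseq (F f x) (N f x))).
Proof.
move=> hN hF.
have : computes A (fun f x => iteri (N f x) (fun i w => (pr w (F f x i)).+1) 0).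
  by computes_tac; apply: (computes2 (R := F)); computes_tac.
apply: computes_ext => f _ x.
by elim: (N f x) => //= n ->; rewrite mkseqS enc_rcons.
Qed.

End ClosureSeq.

Ltac computes_seq_step :=
  lazymatch goal with
  | |- computes _ (fun _ _ => lk _ _) => apply: computes_lk
  | |- computes _ (fun _ _ => slen _) => apply: computes_slen
  | |- computes _ (fun _ _ => enc (mkseq _ _)) => apply: computes_enc_mkseq
  | |- _ => computes_step
  end.

Ltac computes_tac ::= cbv beta; repeat computes_seq_step.

Lemma lk_enc s i : lk (enc s) i = nth 0 s i.
Proof. by rewrite /lk encK. Qed.

Lemma lk_mkseq F n i : lk (enc (mkseq F n)) i = if i < n then F i else 0.
Proof.
rewrite lk_enc; case: ltnP => le; first by rewrite nth_mkseq.
by rewrite nth_default // size_mkseq.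
Qed.

Lemma find_iota (P : pred nat) n k : n < k -> P n -> (forall j, j < n -> ~~ P j) ->
  find P (iota 0 k) = n.
Proof.
move=> nk Pn NP.
have -> : iota 0 k = iota 0 n ++ n :: iota n.+1 (k - n.+1).
  by rewrite -[RHS]/(iota 0 n ++ iota (0 + n) (k - n.+1).+1) -iotaD; congr iota; lia.
rewrite find_cat /= Pn addn0 size_iota.
case: ifP => // /hasP [j]; rewrite mem_iota => lt.
by rewrite (negbTE (NP j _)) //; lia.
Qed.

(** * A universal function with bounded fuel *)

(* One unfolding of an interpreter: [L] answers the recursive calls, a call
   being [pr 0 (pr e x)] (run program [e] on [x]; answer [y.+1] for output [y],
   [0] for no answer) or [pr 1 (pr e 0)] (is [e] the number of a program?).
   The second kind is needed because [Prec c d] may halt without running [d]. *)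
Definition evb (f : nat -> nat) (k : nat) (L : nat -> nat) (p : nat) : nat :=
  let e := pr1 (pr2 p) in let x := pr2 (pr2 p) in
  let h := pr1 e in let a := pr2 e in
  let c := pr1 a in let d := pr2 a in
  if pr1 p == 0 then
    if h == 0 then if a == 0 then 1 else 0
    else if h == 1 then if a == 0 then x.+2 else 0
    else if h == 2 then if a == 0 then (pr1 x).+1 else 0
    else if h == 3 then if a == 0 then (pr2 x).+1 else 0
    else if h == 4 then if a == 0 then (f x).+1 else 0
    else if h == 5 then
      if (0 < L (pr 0 (pr c x))) && (0 < L (pr 0 (pr d x)))
      then (pr (L (pr 0 (pr c x))).-1 (L (pr 0 (pr d x))).-1).+1 else 0
    else if h == 6 then
      if 0 < L (pr 0 (pr d x)) then L (pr 0 (pr c (L (pr 0 (pr d x))).-1)) else 0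
    else if h == 7 then
      if pr2 x == 0 then
        if 0 < L (pr 1 (pr d 0)) then L (pr 0 (pr c (pr1 x))) else 0
      else
        if 0 < L (pr 0 (pr e (pr (pr1 x) (pr2 x).-1))) then
          L (pr 0 (pr d (pr (pr1 x) (pr (pr2 x).-1
            (L (pr 0 (pr e (pr (pr1 x) (pr2 x).-1)))).-1))))
        else 0
    else if h == 8 then
      if L (pr 0 (pr a (pr x (find (fun y => L (pr 0 (pr a (pr x y))) <= 1) (iota 0 k))))) == 1
      then (find (fun y => L (pr 0 (pr a (pr x y))) <= 1) (iota 0 k)).+1 else 0
    else 0
  else
    if h <= 4 then if a == 0 then 1 else 0
    else if h <= 7 then
      if (0 < L (pr 1 (pr c 0))) && (0 < L (pr 1 (pr d 0))) then 1 else 0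
    else if h == 8 then if 0 < L (pr 1 (pr a 0)) then 1 else 0 else 0.

(* With fuel [k] only calls [p < k] are answered, so that the answers form a
   finite table and the oracle is queried below [k] only. *)
Fixpoint ev (f : nat -> nat) (k p : nat) : nat :=
  if k is k'.+1 then if p < k then evb f k' (ev f k') p else 0 else 0.

Definition run (f : nat -> nat) (k e x : nat) : nat := ev f k (pr 0 (pr e x)).

Lemma computes_evb A : computes A (fun f z =>
  evb f (pr1 (pr2 z)) (lk (pr2 (pr2 z))) (pr1 z)).
Proof.
rewrite /evb.
computes_tac.
Qed.

Lemma computes_run A : computes A (fun f z =>
  run f (pr1 z) (pr1 (pr2 z)) (pr2 (pr2 z))).
Proof.
(* Course-of-values recursion: step [i] tabulates the answers with fuel [i.+1] to all calls up to
   [i]. Looking up a larger call yields the default 0, which is also the value of [ev] there. *)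
have ht : computes A (fun f k =>
    iteri k (fun i w => enc (mkseq (evb f i (lk w)) i.+1)) 0).
  computes_tac.
  by apply: (computes3 (R := fun f p i w => evb f i (lk w) p) (computes_evb A)); computes_tac.
have E f k p : lk (iteri k (fun i w => enc (mkseq (evb f i (lk w)) i.+1)) 0) p = ev f k p.
  elim: k p => [|k IH] p /=; first by rewrite /lk nth_nil.
  rewrite lk_mkseq; case: ifP => // _; congr evb.
  by apply/funext => q; apply: IH.
have : computes A (fun f z =>
    lk (iteri (pr1 z) (fun i w => enc (mkseq (evb f i (lk w)) i.+1)) 0)
      (pr 0 (pr2 z))).
  apply: computes_lk; last by computes_tac.
  by apply: (computes_comp ht); computes_tac.
by apply: computes_ext => f _ z; rewrite E /run prK.
Qed.

(** The argument of an oracle query is a component of the call, hence at most the call, which is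
    below the fuel. *)
Lemma ev_use f g k p : (forall q, q < k -> f q = g q) -> ev f k p = ev g k p.
Proof.
elim: k p => [//|k IH] p fg /=; case: ltnP => // lt.
have -> : ev f k = ev g k.
  by apply/funext => q; apply: IH => r rk; apply: fg; apply: ltnW.
rewrite /evb fg //; apply: leq_ltn_trans lt.
rewrite -{2}(prK p) -{2}(prK (pr2 p)).
exact: leq_trans (leq_pr2 _ _) (leq_pr2 _ _).
Qed.

Lemma run_use f g k e x : (forall q, q < k -> f q = g q) -> run f k e x = run g k e x.
Proof. exact: ev_use. Qed.

(** Both kinds of calls go through one induction on the fuel, because [Prec] with counter 0 relies
    on the second program number being valid. *)
Lemma ev_sound f k p :
  (forall y, pr1 p = 0 -> ev f k p = y.+1 -> Phi f (pr1 (pr2 p)) (pr2 (pr2 p)) y) /\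
  (pr1 p <> 0 -> 0 < ev f k p -> exists c, encode c = pr1 (pr2 p)).
Proof.
elim: k p => [//|k IH] p /=; case: ltnP => // _.
have IH0 e x y : ev f k (pr 0 (pr e x)) = y.+1 -> Phi f e x y.
  by have [/(_ y) H _] := IH (pr 0 (pr e x)); rewrite !prE in H; apply: H.
have IH0' e x : 0 < ev f k (pr 0 (pr e x)) ->
    Phi f e x (ev f k (pr 0 (pr e x))).-1.
  by case E: (ev _ _ _) => [//|y] _; apply: IH0.
have IH1 e : 0 < ev f k (pr 1 (pr e 0)) -> exists c, encode c = e.
  by have [_ H] := IH (pr 1 (pr e 0)); rewrite !prE in H; apply: H.
rewrite /evb; move: (ev f k) IH0 IH0' IH1 => L IH0 IH0' IH1 {IH}.
set e := pr1 (pr2 p); set x := pr2 (pr2 p); set a := pr2 e.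
have He h : pr1 e == h -> pr h a = e by move=> /eqP <-; rewrite prK.
have Ha : pr (pr1 a) (pr2 a) = a by rewrite prK.
split=> [y -> |/eqP/negbTE ->] /=.
- case: ifP => [/He E|_]; first by case: eqP E => // -> E [<-]; exists Zero.
  case: ifP => [/He E|_]; first by case: eqP E => // -> E [<-]; exists Succ.
  case: ifP => [/He E|_]; first by case: eqP E => // -> E [<-]; exists Left.
  case: ifP => [/He E|_]; first by case: eqP E => // -> E [<-]; exists Right.
  case: ifP => [/He E|_]; first by case: eqP E => // -> E [<-]; exists Oracle.
  case: ifP => [/He E|_].
    case: ifP => // /andP [/IH0' [c c1 c2] /IH0' [d d1 d2]] [<-].
    by exists (Pair c d); [rewrite /= c1 d1 Ha | apply: eval_pair].
  case: ifP => [/He E|_].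
    case: ifP => // /IH0' [d d1 d2] /IH0 [c c1 c2].
    by exists (Comp c d); [rewrite /= c1 d1 Ha | apply: eval_comp d2 c2].
  case: ifP => [/He E|_].
    case: eqP => x0.
      case: ifP => // /IH1 [d d1] /IH0 [c c1 c2].
      by exists (Prec c d); [rewrite /= c1 d1 Ha | rewrite /= x0].
    case: ifP => // /IH0' [C C1 C2] /IH0 [d' d1 d2].
    (* The recursive call concerns the whole number [e], so the program it yields has to be
       recognized as a [Prec] whose second half is [d'], by injectivity of [encode]. *)
    have [c [d CE]] : exists c d, C = Prec c d.
      by case: (C) C1 => [|||||c0 d0|c0 d0|c0 d0|c0] /=; rewrite -E => /pr_inj [] // _ _; exists c0, d0.
    exists (Prec c d); first by rewrite -CE.
    have dd : d = d'.
      by apply: encode_inj; move: C1; rewrite CE /= -E => /pr_inj [_ H]; rewrite d1 -H prE.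
    move: C2 d2; rewrite CE dd /= !prE; case: (pr2 x) x0 => // m _ /= H1 H2.
    by eexists; [apply: H1 | apply: H2].
  case: ifP => [/He E|//].
  set y' := find _ _; case: eqP => // Ly [<-].
  have [c c1 c2] := IH0 _ _ _ Ly.
  exists (Mu c); first by rewrite /= c1.
  split=> // j jy; have : ~~ (L (pr 0 (pr a (pr x j))) <= 1).
    have jk : j < k by apply: leq_trans jy _; rewrite -[leqRHS](size_iota 0); apply: find_size.
    by have := @before_find _ 0 (fun y => L (pr 0 (pr a (pr x y))) <= 1) (iota 0 k) j jy;
       rewrite nth_iota // add0n => ->.
  case E1: (L _) => [//|[//|v]] _; exists v.
  by have [c' c'1 c'2] := IH0 _ _ _ E1; rewrite -(encode_inj (etrans c'1 (esym c1))).
- case: ifP => [h4|h4].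
    case: eqP => // a0 _; have := He (pr1 e); rewrite eqxx a0 => <- //.
    by case: (pr1 e) h4 => [|[|[|[|[|//]]]]] _; [exists Zero|exists Succ|exists Left|exists Right|exists Oracle].
  case: ifP => [h7|_].
    case: ifP => // /andP [/IH1 [c c1] /IH1 [d d1]] _.
    have := He (pr1 e); rewrite eqxx => <- //.
    case: (pr1 e) h7 (h4) => [|[|[|[|[|[|[|[|//]]]]]]]] // _ _; 
     [exists (Pair c d)|exists (Comp c d)|exists (Prec c d)]; by rewrite /= c1 d1 Ha.
  case: ifP => // /He E; case: ifP => // /IH1 [c c1] _.
  by exists (Mu c); rewrite /= c1.
Qed.

Lemma ev_step f p y k0 :
  (forall k, k0 <= k -> evb f k (ev f k) p = y) ->
  exists k1, forall k, k1 <= k -> ev f k p = y.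
Proof.
move=> H; exists (maxn k0 p).+1 => -[//|k] /=.
by rewrite ltnS geq_max => /andP [/H -> le]; rewrite ltnS le.
Qed.

Lemma ev_code f c : exists k0, forall k, k0 <= k -> ev f k (pr 1 (pr (encode c) 0)) = 1.
Proof.
elim: c => [|||||c [k1 H1] d [k2 H2]|c [k1 H1] d [k2 H2]|c [k1 H1] d [k2 H2]|c [k1 H1]];
  try by apply: (@ev_step _ _ _ 0) => k _; rewrite /evb !prE.
1-3: by apply: (@ev_step _ _ _ (maxn k1 k2)) => k; rewrite geq_max => /andP [/H1 E1 /H2 E2];
  rewrite /evb !prE /= E1 E2.
by apply: (@ev_step _ _ _ k1) => k /H1 E1; rewrite /evb !prE /= E1.
Qed.

Lemma ev_complete f c x y : eval f c x y ->
  exists k0, forall k, k0 <= k -> ev f k (pr 0 (pr (encode c) x)) = y.+1.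
Proof.
elim: c x y => [|||||c IHc d IHd|c IHc d IHd|c IHc d IHd|c IHc] x y /=;
  try by move=> ->; apply: (@ev_step _ _ _ 0) => k _; rewrite /evb !prE.
- move=> [u [v [/IHc [k1 H1] /IHd [k2 H2] ->]]].
  apply: (@ev_step _ _ _ (maxn k1 k2)) => k; rewrite geq_max => /andP [/H1 E1 /H2 E2].
  by rewrite /evb !prE /= E1 E2.
- move=> [u /IHd [k2 H2] /IHc [k1 H1]].
  apply: (@ev_step _ _ _ (maxn k1 k2)) => k; rewrite geq_max => /andP [/H1 E1 /H2 E2].
  by rewrite /evb !prE /= E2 E1.
- rewrite -[X in pr (pr 7 _) X](prK x); elim: (pr2 x) y => [|m IHm] y /=.
    move=> /IHc [k1 H1]; have [k2 H2] := ev_code f d.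
    apply: (@ev_step _ _ _ (maxn k1 k2)) => k; rewrite geq_max => /andP [/H1 E1 /H2 E2].
    by rewrite /evb !prE /= E2 E1.
  move=> [w /IHm [k1 H1] /IHd [k2 H2]].
  apply: (@ev_step _ _ _ (maxn k1 k2)) => k; rewrite geq_max => /andP [/H1 E1 /H2 E2].
  by rewrite /evb !prE /= E1 /= E2.
- move=> [/IHc [k1 H1] ylt].
  (* The finitely many tests below [y] need a common amount of fuel; an answer above 1 is a nonzero
     output shifted by one. *)
  have [k2 H2] : exists k2, forall k, k2 <= k -> forall j, j < y ->
      1 < ev f k (pr 0 (pr (encode c) (pr x j))).
    elim: y ylt {H1} => [|y IH] ylt; first by exists 0.
    have [k2 H2] := IH (fun j jy => ylt j (ltnW jy)).
    have [v /IHc [k3 H3]] := ylt y (ltnSn y).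
    exists (maxn k2 k3) => k; rewrite geq_max => /andP [le2 le3] j.
    rewrite ltnS leq_eqVlt => /orP [/eqP ->|]; last exact: H2.
    by rewrite H3.
  (* The search in [evb] looks only below the fuel, which must therefore exceed [y]. *)
  apply: (@ev_step _ _ _ (maxn (maxn k1 k2) y.+1)) => k.
  rewrite !geq_max => /andP [/andP [/H1 E1 /H2 E2] yk].
  rewrite /evb !prE /= (@find_iota _ y) ?E1 // => j /E2.
  by rewrite -ltnNge.
Qed.

Lemma run_sound f k e x y : run f k e x = y.+1 -> Phi f e x y.
Proof.
by have [/(_ y) H _] := ev_sound f k (pr 0 (pr e x)); rewrite !prE in H; apply: H.
Qed.

Lemma run_complete f e x y : Phi f e x y ->
  exists k0, forall k, k0 <= k -> run f k e x = y.+1.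
Proof. by move=> [c <-]; apply: ev_complete. Qed.

Lemma PhiP f e x y : Phi f e x y <-> exists k, run f k e x = y.+1.
Proof.
split=> [/run_complete [k H]|[k]]; first by exists k; apply: H.
exact: run_sound.
Qed.

Lemma Phi_domP f e x : (exists y, Phi f e x y) <-> exists k, run f k e x != 0.
Proof.
split=> [[y /PhiP [k E]]|[k]]; first by exists k; rewrite E.
by case E: run => [//|y] _; exists y; apply: run_sound E.
Qed.

(** * Turing reducibility *)

Lemma chi_neq0 (X : set nat) n : (chi X n != 0) = `[< X n >].
Proof. by rewrite /chi; case: asboolP. Qed.

Lemma chi_ext (X Y : set nat) m n : (X m <-> Y n) -> chi X m = chi Y n.
Proof. by move=> E; rewrite /chi; congr nat_of_bool; apply: asbool_equiv_eq. Qed.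

Lemma turing_leP X Y : X <=_T Y <-> computes (eq (chi Y)) (fun _ => chi X).
Proof.
split=> [[e eP]|[c cP]]; last by exists (encode c) => n; apply/PhiE/cP.
have [c ce _] := eP 0; exists c => f <- n.
by apply/PhiE; rewrite ce.
Qed.

(** The fixed-oracle case of [computes_subst]; transitivity of Turing reducibility is an
    instance. *)
Lemma computes_relative A X H : computes A (fun _ => chi X) ->
  computes (eq (chi X)) H -> computes A (fun _ => H (chi X)).
Proof.
move=> hX hH.
apply: (@computes_subst _ (eq (chi X)) H (fun _ _ => chi X) (fun _ x => x) (fun _ x => x)) => //;
  try exact: computes_id.
by apply: (computes_comp hX); computes_tac.
Qed.

Lemma turing_le_refl X : X <=_T X.
Proof. by apply/turing_leP; exists Oracle => f <-. Qed.

Lemma turing_le_trans X Y Z : X <=_T Y -> Y <=_T Z -> X <=_T Z.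
Proof. by move=> /turing_leP hX /turing_leP hY; apply/turing_leP; apply: computes_relative hY hX. Qed.

Lemma turing_le_m X Y h : computes (eq (chi Y)) (fun _ n => h n) ->
  (forall n, X n <-> Y (h n)) -> X <=_T Y.
Proof.
move=> hh XY; apply/turing_leP.
apply: computes_ext (computes_oracle hh) => f <- n /=.
by apply: chi_ext; apply: iff_sym; apply: XY.
Qed.

Section ClosureHalf.
Variable A : (nat -> nat) -> Prop.
Implicit Type F : (nat -> nat) -> nat -> nat.

Lemma computes_half F : computes A F -> computes A (fun f x => (F f x)./2).
Proof.
move=> hF.
have : computes A (fun f x => find (fun i => F f x <= i * 2 + 1) (iota 0 (F f x).+1)).
  by computes_tac.
apply: computes_ext => f _ x; set n := F f x.
by apply: find_iota => [||j]; rewrite ?ltnS; lia.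
Qed.

Lemma computes_odd F : computes A F -> computes A (fun f x => odd (F f x)).
Proof.
move=> hF; have hh := computes_half hF.
have : computes A (fun f x => F f x != (F f x)./2 * 2) by computes_tac.
apply: computes_ext => f _ x; congr nat_of_bool; lia.
Qed.

Lemma computes_double F : computes A F -> computes A (fun f x => (F f x).*2).
Proof.
move=> hF; have : computes A (fun f x => F f x + F f x) by computes_tac.
by apply: computes_ext => f _ x; rewrite addnn.
Qed.

End ClosureHalf.

Ltac computes_half_step :=
  lazymatch goal with
  | |- computes _ (fun _ _ => half _) => apply: computes_half
  | |- computes _ (fun _ _ => nat_of_bool (odd _)) => apply: computes_odd
  | |- computes _ (fun _ _ => double _) => apply: computes_double
  | |- _ => computes_seq_step
  end.

Ltac computes_tac ::= cbv beta; repeat computes_half_step.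

Lemma joinf_double f g n : joinf f g n.*2 = f n.
Proof. by rewrite /joinf odd_double doubleK. Qed.

Lemma joinf_doubleS f g n : joinf f g n.*2.+1 = g n.
Proof. by rewrite /joinf /= odd_double /= uphalf_double. Qed.

Lemma chi_join X Y : chi (join X Y) = joinf (chi X) (chi Y).
Proof. by apply/funext => n; rewrite /joinf /chi /join /=; case: (odd n). Qed.

Lemma computes_joinf A f g : computes A (fun _ => f) -> computes A (fun _ => g) ->
  computes A (fun _ => joinf f g).
Proof.
by move=> hf hg; rewrite /joinf; computes_tac.
Qed.

Lemma turing_le_joinl X Y : X <=_T join X Y.
Proof.
apply: (@turing_le_m _ _ double) => [|n]; first by computes_tac.
by rewrite /join /= odd_double doubleK.
Qed.

Lemma turing_le_joinr X Y : Y <=_T join X Y.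
Proof.
apply: (@turing_le_m _ _ (fun n => n.*2.+1)) => [|n]; first by computes_tac.
by rewrite /join /= odd_double /= uphalf_double.
Qed.

Lemma turing_join_le X Y Z : X <=_T Z -> Y <=_T Z -> join X Y <=_T Z.
Proof.
move=> /turing_leP hX /turing_leP hY; apply/turing_leP.
by rewrite chi_join; apply: computes_joinf.
Qed.

(** * The s-m-n and recursion theorems *)

Definition constc (n : nat) : code := iter n (Comp Succ) Zero.

Lemma eval_constc f n x : eval f (constc n) x n.
Proof. by elim: n => //= n IH; exists n. Qed.

Definition smnc (c : code) (p : nat) : code := Comp c (Pair (constc p) (Pair Left Right)).
(** The tags 6 and 5 are those of [Comp] and [Pair], so this is the effect of [smnc] on program
    numbers, as plain arithmetic. *)
Definition smn (e p : nat) : nat :=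
  pr 6 (pr e (pr 5 (pr (encode (constc p)) (encode (Pair Left Right))))).

Lemma encode_smnc c p : encode (smnc c p) = smn (encode c) p.
Proof. by []. Qed.

Lemma eval_smnc f c p x y : eval f (smnc c p) x y <-> eval f c (pr p x) y.
Proof.
have E : eval f (Pair (constc p) (Pair Left Right)) x (pr p x).
  by apply: eval_pair (eval_constc _ _ _) _; exists (pr1 x), (pr2 x); rewrite prK.
split=> [[u uE]|cy]; last by exists (pr p x).
by rewrite (@eval_fun f (Pair (constc p) (Pair Left Right)) _ _ _ uE E).
Qed.

Lemma computes_smn A F G : computes A F -> computes A G ->
  computes A (fun f x => smn (F f x) (G f x)).
Proof.
move=> hF hG; rewrite /smn; computes_tac.
have : computes A (fun f x => iter (G f x) (fun w => pr 6 (pr (pr 1 0) w)) (pr 0 0)).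
  by computes_tac.
by apply: computes_ext => f _ x; elim: (G f x) => //= n ->.
Qed.

Ltac computes_smn_step :=
  first
  [ match goal with
    | H : computes _ (fun _ z => ?R (pr1 z) (pr2 z))
      |- computes _ (fun f x => ?R (@?a f x) (@?b f x)) =>
        apply: (computes2 (R := fun _ => R) H)
    | H : computes _ (fun _ z => nat_of_bool (?R (pr1 z) (pr2 z)))
      |- computes _ (fun f x => nat_of_bool (?R (@?a f x) (@?b f x))) =>
        apply: (computes2 (R := fun _ m n => nat_of_bool (R m n)) H)
    | H : computes _ (fun _ z => ?R (pr1 z) (pr1 (pr2 z)) (pr2 (pr2 z)))
      |- computes _ (fun f x => ?R (@?a f x) (@?b f x) (@?c f x)) =>
        apply: (computes3 (R := fun _ => R) H)
    end
  | lazymatch goal with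
    | |- computes _ (fun _ _ => smn _ _) => apply: computes_smn
    | |- _ => computes_half_step
    end ].

Ltac computes_tac ::= cbv beta; repeat computes_smn_step.

(* Only the number of the program is made available to itself, so no universal
   program is involved. *)
Lemma recursion_theorem A (F : (nat -> nat) -> nat -> nat -> nat) :
  computes A (fun f z => F f (pr1 z) (pr2 z)) ->
  exists c, forall f, A f -> forall x, eval f c x (F f (encode c) x).
Proof.
move=> hF.
have [d dP] : computes A (fun f z => F f (smn (pr1 z) (pr1 z)) (pr2 z)).
  by apply: (computes2 (R := F)); computes_tac.
(* Diagonalization: the number of this program is [smn (encode d) (encode d)], the very number that
   [d] hands to [F]. *)
exists (smnc d (encode d)) => f Af x; apply/eval_smnc.
by have := dP f Af (pr (encode d) x); rewrite !prE.
Qed.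

(** The program numbered [smn (encode c) n] halts exactly when [n] is in [X], whatever its input,
    hence also on its own number. *)
Lemma turing_le_jump X : X <=_T jump X.
Proof.
have [c cP] : exists c, forall f, True -> forall x,
    (exists y, eval f c x y) <-> exists y : nat, f (pr1 x) != 0.
  by apply: (@search_code (fun _ => True) (fun f x _ => f (pr1 x) != 0)); computes_tac.
apply: (@turing_le_m _ _ (smn (encode c))) => [|n]; first by computes_tac.
have := cP (chi X) I (pr n (smn (encode c) n)); rewrite prE chi_neq0 => E.
rewrite /jump /=; split=> [Xn|[y]].
  have [|y Hy] := E.2 _; first by exists 0; apply/asboolP.
  by exists y; rewrite -encode_smnc; apply/PhiE/eval_smnc.
rewrite -{1}encode_smnc => /PhiE/eval_smnc Hy.
by have [|_ /asboolP] := E.1 _; first by exists y.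
Qed.

(** Otherwise some program would halt exactly outside the jump, which is contradictory at its own
    number. *)
Lemma jump_not_le X : ~ jump X <=_T X.
Proof.
move=> /turing_leP hX.
have [c cP] : exists c, forall f, chi X = f -> forall x,
    (exists y, eval f c x y) <-> exists y : nat, chi (jump X) x == 0.
  apply: (@search_code (eq (chi X)) (fun f x _ => chi (jump X) x == 0)).
  by apply: computes_eq0; apply: (computes_comp hX); computes_tac.
have := cP _ erefl (encode c); rewrite -[_ == 0]negbK chi_neq0 => E.
have [J|NJ] := EM (jump X (encode c)).
  have [y /PhiE Hy] := J.
  by have [|_ /asboolP] := E.1 _; first by exists y.
have [|y Hy] := E.2 _; first by exists 0; apply/asboolP.
by apply: NJ; exists y; apply/PhiE.
Qed.

(** * Well-founded trees and Pi^1_1 sets *)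

Definition wf_tree (T : seq nat -> Prop) : Prop :=
  forall f, exists k, ~ T (mkseq f k).

Definition closed_tree (T : seq nat -> Prop) : Prop :=
  forall s k, T (rcons s k) -> T s.

(** Inductive form of well-foundedness below [s], available for bar induction; [s] itself need not
    lie in [T]. *)
Inductive bar (T : seq nat -> Prop) (s : seq nat) : Prop :=
  Bar : (forall k, T (rcons s k) -> bar T (rcons s k)) -> bar T s.

(** If the root is not barred, choosing an unbarred child again and again produces an infinite
    path. *)
Lemma wf_tree_bar T : closed_tree T -> wf_tree T -> bar T [::].
Proof.
move=> cl wf; apply: contrapT => N0.
have next s : exists k, ~ bar T s -> T (rcons s k) /\ ~ bar T (rcons s k).
  have [b|nb] := EM (bar T s); first by exists 0.
  apply: contrapT => N; apply: nb; constructor=> k Tk.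
  by apply: contrapT => nb; apply: N; exists k.
have [g gP] := choice next.
pose l k := iter k (fun s => rcons s (g s)) [::].
have lE k : l k = mkseq (g \o l) k by elim: k => //= k IH; rewrite mkseqS -IH.
have Nb k : ~ bar T (l k) by elim: k => //= k /gP [].
have [k] := wf (g \o l); rewrite -lE; apply.
by apply: cl (g (l k)) _; have [] := gP _ (Nb k).
Qed.

Lemma bar_wf_tree T : bar T [::] -> wf_tree T.
Proof.
move=> b f; have [s /= b' [k sE]] : exists2 s, bar T s & exists k, s = mkseq f k.
  by exists [::] => //; exists 0.
elim: b' k sE => {}s _ IH k sE.
have [Tk|NT] := EM (T (rcons s (f k))); last by exists k.+1; rewrite mkseqS -sE.
by apply: (IH (f k) Tk k.+1); rewrite mkseqS -sE.
Qed.

(** The admissible oracles are those with even half [chi X]; the odd half is the quantified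
    function. Computable matrices with one number quantifier thus receive an index in the
    enumeration [V]. *)
Lemma V_search X (P : (nat -> nat) -> nat -> nat -> bool) :
  computes (fun g => forall n, g n.*2 = chi X n)
    (fun g z => P (fun n => g n.*2.+1) (pr1 z) (pr2 z)) ->
  exists i, forall n, V i X n <-> forall f, exists y, P f n y.
Proof.
move=> hP; have [c cP] := @search_code _ (fun g => P (fun n => g n.*2.+1)) hP.
exists (encode c) => n.
have E f : (fun n => joinf (chi X) f n.*2.+1) = f.
  by apply/funext => m; rewrite joinf_doubleS.
have {}cP f : (exists y, eval (joinf (chi X) f) c n y) <-> exists y, P f n y.
  by rewrite -{2}(E f); apply: cP => m; rewrite joinf_double.
split=> H f; last by have [|y Hy] := (cP f).2 _ => //; exists y; apply/PhiE.
by apply/cP; have [y /PhiE Hy] := H f; exists y.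
Qed.

(** Sequences that do not yet witness that program [i] halts on [n], with fuel up to their length.
    Fuel [k] queries the oracle below [k] only, so the zeros that pad [s] are never read. *)
Definition V_tree (X : set nat) (i n s : nat) : bool :=
  all (fun k => run (joinf (chi X) (lk s)) k i n == 0) (iota 0 (slen s).+1).

Lemma joinf_use f g h k q : (forall r, r < k -> g r = h r) -> q < k ->
  joinf f g q = joinf f h q.
Proof. by move=> gh qk; rewrite /joinf; case: ifP => // _; apply: gh; lia. Qed.

Lemma V_tree_closed X i n : closed_tree (fun s => V_tree X i n (enc s)).
Proof.
move=> s k /allP H; apply/allP => j; rewrite mem_iota /slen encK => /andP [_ js].
have /H /eqP <- : j \in iota 0 (slen (enc (rcons s k))).+1.
  by rewrite mem_iota /slen encK size_rcons; lia.
apply/eqP/run_use => q qj; apply: joinf_use qj => r rj.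
by rewrite !lk_enc nth_rcons; case: ltnP => //; lia.
Qed.

Lemma V_treeP X i n : V i X n <-> wf_tree (fun s => V_tree X i n (enc s)).
Proof.
have E f j k : k <= j ->
    run (joinf (chi X) (lk (enc (mkseq f j)))) k i n = run (joinf (chi X) f) k i n.
  move=> kj; apply: run_use => q qk; apply: joinf_use qk => r rk.
  by rewrite lk_mkseq (leq_trans rk kj).
split=> H f.
  have [k Hk] := (Phi_domP _ _ _).1 (H f); exists k => /allP/(_ k).
  rewrite mem_iota /slen encK size_mkseq ltnSn => /(_ isT).
  by rewrite E // (negbTE Hk).
have [j /negP/allPn [k]] := H f; rewrite mem_iota /slen encK size_mkseq ltnS => /andP [_ kj].
by rewrite E // => Hk; apply/Phi_domP; exists k.
Qed.

Lemma computes_V_tree X i :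
  computes (eq (chi X)) (fun _ z => V_tree X i (pr1 z) (pr2 z)).
Proof.
have hX : computes (eq (chi X)) (fun _ => chi X) by exists Oracle => f <-.
rewrite /V_tree; apply: computes_all; first by computes_tac.
apply: computes_eq0.

have hJ : computes (eq (chi X)) (fun _ z => joinf (chi X) (lk (pr1 z)) (pr2 z)).
  by rewrite /joinf; computes_tac.
have : computes (eq (chi X)) (fun _ z => (fun f w => run f (pr1 w) (pr1 (pr2 w)) (pr2 (pr2 w)))
    (joinf (chi X) (lk (pr2 (pr1 z)))) (pr (pr2 z) (pr i (pr1 (pr1 z))))).
  apply: (computes_subst (B := fun _ => True) (G := fun _ s => joinf (chi X) (lk s))
    (computes_run _) _ hJ) => //; computes_tac.
by apply: computes_ext => f _ z; rewrite !prE.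
Qed.

(** * Kleene's O *)

Lemma expn2_neq_limit a e : 2 ^ a <> 3 * 5 ^ e.
Proof.
move=> E; have : odd (2 ^ a) by rewrite E oddM oddX orbT.
by rewrite oddX orbF => /eqP a0; move: E; rewrite a0; have := expn_gt0 5 e; lia.
Qed.

Lemma expn2_inj a b : 2 ^ a = 2 ^ b -> a = b.
Proof. exact: (@expnI 2). Qed.

Lemma limit_inj e d : 3 * 5 ^ e = 3 * 5 ^ d -> e = d.
Proof. by move=> E; apply: (@expnI 5) => //; lia. Qed.

Section TreeNotation.
Variables (X : set nat) (T : nat -> nat -> bool).
Hypothesis hT : computes (eq (chi X)) (fun _ z => T (pr1 z) (pr2 z)).
Hypothesis clT : forall n, closed_tree (fun s => T n (enc s)).

(* [N n a s] is a notation, above the notation [a], for a limit of the sequence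
   that starts with [a] and goes above [N n _ (rcons s k)] at step [k]. Starting
   from a given [a] makes addition of notations unnecessary. *)
Lemma tree_notation : exists (N : nat -> nat -> seq nat -> nat)
    (phi : nat -> nat -> seq nat -> nat -> nat),
  [/\ computes (fun _ => True) (fun _ n => N n 1 [::]),
      forall n a s, exists2 e, N n a s = 3 * 5 ^ e &
        forall k, Phi (chi X) e k (phi n a s k),
      forall n a s, phi n a s 0 = a
    & forall n a s k, phi n a s k.+1 =
        if T n (enc (rcons s k)) then 2 ^ N n (phi n a s k) (rcons s k)
        else 2 ^ phi n a s k].
Proof.
(* Here [z] is [pr (pr n (pr a (enc s))) k] and [e] stands for the number of the program itself, so
   [smn e] produces the index of the limit attached to the child node [(pr (enc s) j).+1], that is
   [enc (rcons s j)]. *)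
pose F e z := iteri (pr2 z)
  (fun j b => if T (pr1 (pr1 z)) (pr (pr2 (pr2 (pr1 z))) j).+1
    then 2 ^ (3 * 5 ^ smn e (pr (pr1 (pr1 z)) (pr b (pr (pr2 (pr2 (pr1 z))) j).+1)))
    else 2 ^ b) (pr1 (pr2 (pr1 z))).
have hF : computes (eq (chi X)) (fun _ z => F (pr1 z) (pr2 z)).
  by rewrite /F; computes_tac.
have [c cP] := recursion_theorem (F := fun _ => F) hF.
exists (fun n a s => 3 * 5 ^ smn (encode c) (pr n (pr a (enc s)))).
exists (fun n a s k => F (encode c) (pr (pr n (pr a (enc s))) k)); split.
- by computes_tac.
- move=> n a s; eexists; first by [].
  by move=> k; rewrite -encode_smnc; apply/PhiE/eval_smnc/cP.
- by move=> n a s; rewrite /F !prE.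
- by move=> n a s k; rewrite /F !prE /= enc_rcons.
Qed.

(** Bar induction makes [N] a notation when the tree is well-founded; conversely, induction on
    membership in O recovers the bar. *)
Lemma tree_hyperjump : exists2 h : nat -> nat,
  computes (fun _ => True) (fun _ => h) &
  forall n, wf_tree (fun s => T n (enc s)) <-> kleeneO X (h n).
Proof.
have [N [phi [hN NE phi0 phiS]]] := tree_notation.
exists (fun n => N n 1 [::]) => // n.
have fwd s : bar (fun s => T n (enc s)) s -> forall a, kleeneO X a ->
    kleeneO X (N n a s) /\ kleeneO_lt X a (N n a s).
  elim=> {}s _ IH a Oa.
  have H k : kleeneO X (phi n a s k) /\
      (kleeneO X (phi n a s k) ->
       kleeneO X (phi n a s k.+1) /\ kleeneO_lt X (phi n a s k) (phi n a s k.+1)).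
    have S k' : kleeneO X (phi n a s k') ->
        kleeneO X (phi n a s k'.+1) /\ kleeneO_lt X (phi n a s k') (phi n a s k'.+1).
      move=> Ok; rewrite phiS; case: ifP => [Tk|_].
        have [O1 lt1] := IH _ Tk _ Ok; split; first exact: kleeneO_succ.
        by apply: kleeneO_lt_trans lt1 _; apply: kleeneO_lt_succ.
      by split; [apply: kleeneO_succ|apply: kleeneO_lt_succ].
    by split; [elim: k => [|k /S []] //; rewrite phi0 | apply: S].
  have O1 k : kleeneO X (phi n a s k) by have [] := H k.
  have lt1 k : kleeneO_lt X (phi n a s k) (phi n a s k.+1) by have [h1 []] := H k.
  have [e -> eP] := NE n a s; split; first exact: kleeneO_lim eP O1 lt1.
  by have := kleeneO_lt_lim 0 eP O1 lt1; rewrite phi0.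
(* The alternative with [2 ^] is needed because the notation of a child enters the fundamental
   sequence through its successor. *)
have bwd m : kleeneO X m -> forall a s, m = N n a s \/ m = 2 ^ N n a s ->
    bar (fun s => T n (enc s)) s.
  elim=> {m} [|m Om IH|e g gP Og IH _] a s; have [d Nd dP] := NE n a s; rewrite Nd.
  - by case=> [|/(@expn2_inj 0)]; have := expn_gt0 5 d; lia.
  - case=> [/expn2_neq_limit //|/expn2_inj mE].
    by apply: (IH a s); left; rewrite mE.
  - case=> [/limit_inj E|/esym/expn2_neq_limit //].
    constructor=> k Tk; apply: (IH k.+1 (phi n a s k)); right.
    rewrite E in gP; rewrite (Phi_fun (gP k.+1) (dP k.+1)) phiS.
    by rewrite Tk.
split=> [/(wf_tree_bar (@clT n))/fwd/(_ 1 (kleeneO_zero X)) [] //|].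
by move=> /bwd/(_ 1 [::] (or_introl erefl))/bar_wf_tree.
Qed.

End TreeNotation.

Lemma V_le_hyperjump i X : V i X <=_T hyperjump X.
Proof.
have [h hh hP] := tree_hyperjump (@computes_V_tree X i) (@V_tree_closed X i).
apply: (turing_le_m (h := h)); first exact: computes_sub hh.
by move=> n; rewrite -[hyperjump X _]hP V_treeP.
Qed.

Lemma jump_V X : exists i, forall n, V i X n <-> jump X n.
Proof.
have [|i iP] := @V_search X (fun _ n y => run (chi X) y n n != 0).
  have hX : computes (fun g => forall n, g n.*2 = chi X n) (fun _ => chi X).
    apply: (@computes_ext _ (fun g n => g n.*2)) => //; computes_tac.
  have hr := computes_relative hX (computes_run _).
  by computes_tac.
exists i => n; rewrite iP; split=> [/(_ id)|] H; first exact/Phi_domP.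
by move=> _; apply/Phi_domP.
Qed.

Lemma set_ext (X Y : set nat) : (forall n, X n <-> Y n) -> X = Y.
Proof. by move=> XY; apply/seteqP; split=> n /XY. Qed.

Lemma jump_le_hyperjump X : jump X <=_T hyperjump X.
Proof. by have [i /set_ext <-] := jump_V X; apply: V_le_hyperjump. Qed.

Lemma le_hyperjump X : X <=_T hyperjump X.
Proof. exact: turing_le_trans (turing_le_jump X) (jump_le_hyperjump X). Qed.

(** The immediate predecessors that a number names as a notation; [u <> 0] is required because 2^0
    denotes zero, which has none. *)
Definition child (f : nat -> nat) (v u : nat) : Prop :=
  (u <> 0 /\ v = 2 ^ u) \/ exists e m, v = 3 * 5 ^ e /\ Phi f e m u.

Inductive descendant (f : nat -> nat) (v : nat) : nat -> Prop :=
| descendant_child u : child f v u -> descendant f v u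
| descendant_trans u t : descendant f v u -> child f u t -> descendant f v t.

Definition locally_good (f : nat -> nat) (v : nat) : Prop :=
  (exists u, v = 2 ^ u) \/
  exists2 e, v = 3 * 5 ^ e &
    forall m, exists u u', [/\ Phi f e m u, Phi f e m.+1 u' & descendant f u' u].

(** The simultaneous definition of O and its order is replaced by a single induction along [child]
    over an arithmetical condition. *)
Inductive good (f : nat -> nat) (v : nat) : Prop :=
  Good : locally_good f v -> (forall u, child f v u -> good f u) -> good f v.

Lemma kleeneO_gt0 X a : kleeneO X a -> a <> 0.
Proof.
by case=> [|b _|e g _ _ _]; try have := expn_gt0 2 b; try have := expn_gt0 5 e; lia.
Qed.

Lemma kleeneO_lt_descendant X b a : kleeneO_lt X b a -> descendant (chi X) a b.
Proof.
elim=> {b a} [a Oa|e g n gP _ _|a b c _ ba _ cb].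
- by constructor; left; split=> //; apply: kleeneO_gt0 Oa.
- by constructor; right; exists e, n.
- elim: ba => [u bu|u t _ cu ut]; first exact: descendant_trans cb bu.
  exact: descendant_trans cu ut.
Qed.

Lemma kleeneO_child X a b : kleeneO X a -> child (chi X) a b ->
  kleeneO X b /\ kleeneO_lt X b a.
Proof.
case=> [|c Oc|e g gP Og lg] [[b0 E]|[d [m [E mb]]]].
- by move: E => /(@expn2_inj 0) /esym.
- by move: E => /(@expn2_neq_limit 0).
- by move/expn2_inj: E => <-; split=> //; apply: kleeneO_lt_succ.
- by move/expn2_neq_limit: E.
- by move/esym/expn2_neq_limit: E.
- move/limit_inj: E mb => <- mb; rewrite (Phi_fun mb (gP m)); split=> //.
  exact: kleeneO_lt_lim.
Qed.

Lemma kleeneO_descendant X a b : kleeneO X a -> descendant (chi X) a b ->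
  kleeneO X b /\ kleeneO_lt X b a.
Proof.
move=> Oa; elim=> [u /kleeneO_child|u t _ [Ou lu] /(kleeneO_child Ou) [Ot lt]]; first exact.
by split=> //; apply: kleeneO_lt_trans lt lu.
Qed.

Lemma kleeneO_locally_good X a : kleeneO X a -> locally_good (chi X) a.
Proof.
case=> [|c _|e g gP Og lg]; [by left; exists 0|by left; exists c|].
right; exists e => // m; exists (g m), (g m.+1); split=> //.
exact: kleeneO_lt_descendant.
Qed.

(** For members of O, descending through [child] is the same as going down in the order of O, so
    local goodness expresses the increase required at limits. *)
Lemma kleeneO_good X a : kleeneO X a <-> good (chi X) a.
Proof.
split.
  elim=> {a} [|a Oa IH|e g gP Og IH lg]; constructor;
    try exact/kleeneO_locally_good/kleeneO_zero;
    try exact/kleeneO_locally_good/kleeneO_succ;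
    try exact/kleeneO_locally_good/(kleeneO_lim gP Og lg).
  - move=> u [[u0 /(@expn2_inj 0) /esym //]|[e [m [/(@expn2_neq_limit 0) //]]]].
  - move=> u [[u0 /expn2_inj <-] //|[e [m [/expn2_neq_limit //]]]].
  - move=> u [[u0 /esym/expn2_neq_limit //]|[d [m [/limit_inj <- mu]]]].
    by rewrite (Phi_fun mu (gP m)).
elim=> {}a loc _ IH; case: loc => [[u aE]|[e aE eP]].
  have [u0|/eqP u0] := eqVneq u 0; first by rewrite aE u0; apply: kleeneO_zero.
  by rewrite aE; apply/kleeneO_succ/IH; left.
have /choice [g gP] : forall m, exists u, Phi (chi X) e m u.
  by move=> m; have [u [_ [H _ _]]] := eP m; exists u.
have Og m : kleeneO X (g m) by apply: IH; right; exists e, m.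
rewrite aE; apply: (kleeneO_lim gP) => // m.
have [u [u' [H H' D]]] := eP m; apply: (kleeneO_descendant (Og m.+1) _).2.
by rewrite (Phi_fun (gP m) H) (Phi_fun (gP m.+1) H').
Qed.

Definition log2 (v : nat) : nat := find (fun i => 2 ^ i == v) (iota 0 v.+1).
Definition loglim (v : nat) : nat := find (fun i => 3 * 5 ^ i == v) (iota 0 v.+1).

Lemma log2K u : log2 (2 ^ u) = u.
Proof.
apply: find_iota => [||j ju]; rewrite ?ltnS ?eqxx //; first exact/ltnW/ltn_expl.
by apply/eqP => /expn2_inj; lia.
Qed.

Lemma loglimK e : loglim (3 * 5 ^ e) = e.
Proof.
apply: find_iota => [||j ju]; rewrite ?eqxx //.
  by have := @ltn_expl 5 e isT; lia.
by apply/eqP => /limit_inj; lia.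
Qed.

(* The child of [v] with witness [w], plus one; [0] if [w] witnesses no child. *)
Definition next (f : nat -> nat) (v w : nat) : nat :=
  if 2 ^ log2 v == v then if log2 v == 0 then 0 else (log2 v).+1
  else if 3 * 5 ^ loglim v == v then run f (pr1 w) (loglim v) (pr2 w) else 0.

(** The walk from [a] along the choices [w], again shifted by one: [v.+1] means that it has reached
    [v], and 0 that it has died, which persists. *)
Definition chain (f : nat -> nat) (w : nat -> nat) (a k : nat) : nat :=
  iteri k (fun i u => if u == 0 then 0 else next f u.-1 (w i)) a.+1.

Lemma nextP f v u : child f v u <-> exists w, next f v w = u.+1.
Proof.
split=> [[[u0 ->]|[e [m [-> /PhiP [k mu]]]]]|[w]].
- by exists 0; rewrite /next log2K eqxx; move/eqP/negbTE: u0 => ->.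
- exists (pr k m); rewrite /next loglimK eqxx !prE; case: eqP => // /expn2_neq_limit //.
- rewrite /next; case: eqP => [<-|_].
    by rewrite log2K; case: eqP => // u0 [<-]; left.
  case: eqP => // <-; rewrite loglimK => /run_sound H.
  by right; exists (loglim v), (pr2 w).
Qed.

Lemma chain_use f w w' a k : (forall i, i < k -> w i = w' i) ->
  chain f w a k = chain f w' a k.
Proof.
rewrite /chain; elim: k => //= k IH ww'; rewrite IH ?ww' // => i ik.
by apply: ww'; apply: ltnW.
Qed.

Lemma descendantP f a b :
  descendant f a b <-> exists w k, 0 < k /\ chain f (lk w) a k = b.+1.
Proof.
split.
  elim=> [u /nextP [w wu]|u t _ [w [k [k0 wk]]] /nextP [x xt]].
    by exists (enc [:: w]), 1; rewrite /chain /= lk_enc.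
  exists (enc (mkseq (fun i => if i < k then lk w i else x) k.+1)), k.+1; split=> //.
  rewrite -[LHS]/(if chain f _ a k == 0 then 0 else next f (chain f _ a k).-1 (lk _ k)).
  have -> : chain f (lk (enc (mkseq (fun i => if i < k then lk w i else x) k.+1))) a k = u.+1.
    by rewrite -wk; apply: chain_use => i ik; rewrite lk_mkseq ik ltnS ltnW.
  by rewrite /= lk_mkseq ltnn ltnSn.
move=> [w [k [k0]]]; elim: k k0 b => // k IH _ b.
rewrite -[chain _ _ _ _]/(if chain f (lk w) a k == 0 then 0
  else next f (chain f (lk w) a k).-1 (lk w k)).
case E: (chain _ _ _ k) => [//|v] /= H.
have vb : child f v b by apply/nextP; exists (lk w k).
case: k E IH {H} => [|k] E IH; first by constructor; move: E => [->].
by apply: descendant_trans vb; apply: IH.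
Qed.

(** The witness [t] packs the fuel, a sequence of choices and its length. Both sides of the last
    equation carry the same shift by one. *)
Definition locally_good_by (f : nat -> nat) (v m t : nat) : bool :=
  (2 ^ log2 v == v) ||
  [&& 3 * 5 ^ loglim v == v, 0 < run f (pr1 t) (loglim v) m,
      0 < run f (pr1 t) (loglim v) m.+1, 0 < pr2 (pr2 t) &
      chain f (lk (pr1 (pr2 t))) (run f (pr1 t) (loglim v) m.+1).-1 (pr2 (pr2 t))
        == run f (pr1 t) (loglim v) m].

Lemma locally_goodP f v :
  locally_good f v <-> forall m, exists t, locally_good_by f v m t.
Proof.
rewrite /locally_good_by; split=> [[[u ->] m|[e -> eP] m]|H].
- by exists 0; rewrite log2K eqxx.
- have [u [u' [/run_complete [k1 H1] /run_complete [k2 H2] /descendantP [w [k [k0 wk]]]]]] := eP m.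
  exists (pr (maxn k1 k2) (pr w k)); rewrite loglimK !prE.
  by rewrite H1 ?leq_maxl // H2 ?leq_maxr // wk !eqxx k0 orbT.
have [/eqP E|N] := boolP (2 ^ log2 v == v); first by left; exists (log2 v).
have [/eqP E|N'] := boolP (3 * 5 ^ loglim v == v); last first.
  by have [t] := H 0; rewrite (negbTE N) (negbTE N').
right; exists (loglim v) => // m; have [t] := H m; rewrite (negbTE N) E eqxx /=.
case E1: run => [//|u] /=; case E2: run => [//|u'] /= /andP [k0 /eqP ch].
exists u, u'; split; [exact: run_sound E1|exact: run_sound E2|].
by apply/descendantP; exists (pr1 (pr2 t)), (pr2 (pr2 t)).
Qed.

(** Passing from the inductive definition to quantification over choice sequences exposes the Pi^1_1
    form of O. *)
Lemma goodP f a : good f a <->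
  (forall w, exists k, chain f w a k = 0) /\
  (forall w k v, chain f w a k = v.+1 -> locally_good f v).
Proof.
have chS w k : chain f w a k.+1 =
    if chain f w a k == 0 then 0 else next f (chain f w a k).-1 (w k) by [].
split=> [ga|[wf loc]].
  have G w k v : chain f w a k = v.+1 -> good f v.
    elim: k v => [v [<-] //|k IH v]; rewrite chS.
    case E: (chain f w a k) => [//|u] /= H.
    by have [_] := IH u E; apply; apply/nextP; exists (w k).
  split=> [w|w k v /G []] //; apply: contrapT => N.
  have [k [v kv]] : exists k v, chain f w a k = v.+1 by exists 0, a.
  have gv := G _ _ _ kv; elim: gv k kv => {}v _ _ IH k kv.
  case E: (chain f w a k.+1) => [|u]; first by apply: N; exists k.+1.
  apply: (IH u _ k.+1 E); apply/nextP; exists (w k).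
  by move: E; rewrite chS kv.
apply: contrapT => Na.
(* A number that is locally good but not good has a child that is not good; iterating these choices
   from [a] gives a chain that never dies. *)
have step v : exists w, locally_good f v -> ~ good f v ->
    exists2 u, next f v w = u.+1 & ~ good f u.
  have [[lv nv]|nlv] := EM (locally_good f v /\ ~ good f v); last first.
    by exists 0 => lv nv; case: nlv.
  suff [u /nextP [w wu] nu] : exists2 u, child f v u & ~ good f u by exists w => _ _; exists u.
  apply: contrapT => N; apply: nv; constructor; first exact: lv.
  move=> u vu.
  by apply: contrapT => nu; apply: N; exists u.
have [g gP] := choice step.
pose c k := iter k (fun u => if u == 0 then 0 else next f u.-1 (g u.-1)) a.+1.
have cE k : c k = chain f (fun i => g (c i).-1) a k by elim: k => [//|k IH]; rewrite chS -IH.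
have cP k : exists2 v, c k = v.+1 & ~ good f v.
  elim: k => [|k [v kv nv]]; first by exists a.
  have lv : locally_good f v by apply: (loc _ k v (etrans (esym (cE k)) kv)).
  by have [u vu nu] := gP v lv nv; exists u; rewrite // /c iterS -/(c k) kv.
by have [k] := wf (fun i => g (c i).-1); rewrite -cE; have [v ->] := cP k.
Qed.

Lemma hyperjump_V X : exists i, forall n, V i X n <-> kleeneO X n.
Proof.
pose A (g : nat -> nat) := forall n, g n.*2 = chi X n.
have hX : computes A (fun _ => chi X).
  by apply: (@computes_ext _ (fun g n => g n.*2)) => //; computes_tac.
have hr := computes_relative hX (computes_run _).
have hl : computes A (fun _ => log2) by rewrite /log2; computes_tac.
have hm : computes A (fun _ => loglim) by rewrite /loglim; computes_tac.
have hn : computes A (fun _ z => next (chi X) (pr1 z) (pr2 z)).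
  by rewrite /next; computes_tac.
(* One function carries both conditions of [goodP]: [f \o S] is a choice sequence whose chain must
   die, while [f 0] codes a finite chain, its length and the instance of local goodness to check at
   its end. Accordingly [y] pairs a length with a witness. *)
pose P (f : nat -> nat) n y :=
  (chain (chi X) (f \o S) n (pr1 y) == 0) &&
  ((chain (chi X) (lk (pr1 (pr1 (f 0)))) n (pr2 (pr1 (f 0))) == 0) ||
   locally_good_by (chi X)
     (chain (chi X) (lk (pr1 (pr1 (f 0)))) n (pr2 (pr1 (f 0)))).-1 (pr2 (f 0)) (pr2 y)).
have [|i iP] := @V_search X P.
  by rewrite /P /locally_good_by /chain /comp; computes_tac.
exists i => n; rewrite iP kleeneO_good goodP; split.
  move=> H; split=> [w|w k v kv].
    have [y] := H (fun i => if i is j.+1 then w j else 0).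
    by move=> /andP [/eqP H1 _]; exists (pr1 y).
  apply/locally_goodP => m.
  have [y] := H (fun=> pr (pr (enc (mkseq w k)) k) m).
  rewrite /P !prE => /andP [_].
  have -> : chain (chi X) (lk (enc (mkseq w k))) n k = v.+1.
    by rewrite -kv; apply: chain_use => j jk; rewrite lk_mkseq jk.
  by move=> /= H1; exists (pr2 y).
move=> [wf loc] f; have [k k0] := wf (f \o S).
rewrite /P; case E: (chain (chi X) (lk _) n _) => [|v]; first by exists (pr k 0); rewrite prE k0.
have [t ht] := (locally_goodP _ _).1 (loc _ _ _ E) (pr2 (f 0)).
by exists (pr k t); rewrite !prE k0 eqxx ht.
Qed.

(** * Comparison of well-orderings *)

Definition slt (R : nat -> nat -> Prop) x y : Prop := R x y /\ x <> y.

(** The image need not be an initial segment. Between well-orderings this still gives the order of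
    types, and such maps are easier to build and compose. *)
Definition emb (R S : nat -> nat -> Prop) : Prop :=
  exists2 h : nat -> nat, forall x, Defs.field R x -> Defs.field S (h x) &
    forall x y, slt R x y -> slt S (h x) (h y).

Section WellOrdering.
Variable R : nat -> nat -> Prop.
Hypothesis wR : well_ordering R.

Lemma wo_field x y : R x y -> R x x /\ R y y.
Proof. by case: wR => + _ _ _ => /[apply]. Qed.

Lemma wo_trans y x z : R x y -> R y z -> R x z.
Proof. by case: wR => _ + _ _; apply. Qed.

Lemma wo_anti x y : R x y -> R y x -> x = y.
Proof. by case: wR => _ _ + _; apply. Qed.

Lemma wo_least (A : set nat) : (exists2 x, R x x & A x) ->
  exists x, [/\ R x x, A x & forall y, R y y -> A y -> R x y].
Proof.
move=> [x Rx Ax]; case: wR => _ _ _ /(_ [set y | R y y /\ A y]) [] //.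
- by move=> y [].
- by exists x.
- by move=> y [Ry Ay] H; exists y; split=> // z Rz Az; apply: H.
Qed.

Lemma wo_total x y : R x x -> R y y -> [\/ slt R x y, x = y | slt R y x].
Proof.
move=> Rx Ry; have [xy|/eqP xy] := eqVneq x y; first by constructor 2.
have [|z [_ [->|->] zP]] := @wo_least (fun z => z = x \/ z = y).
- by exists x => //; left.
- by constructor 1; split=> //; apply: zP => //; right.
- by constructor 3; split; [apply: zP => //; left | move/esym].
Qed.

Lemma wo_ind (P : nat -> Prop) :
  (forall x, R x x -> (forall y, slt R y x -> P y) -> P x) -> forall x, R x x -> P x.
Proof.
move=> IH x Rx; apply: contrapT => NP.
have [|z [Rz NPz zP]] := @wo_least (fun z => ~ P z); first by exists x.
apply: NPz; apply: IH => // y [yz nyz]; apply: contrapT => NPy; apply: nyz.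
by apply: wo_anti => //; apply: zP => //; have [] := wo_field yz.
Qed.

(** No point satisfies [h x] below [x], since [h x] would be a smaller point of the same kind; but
    [a] is such a point. *)
Lemma no_bounded_self_emb (h : nat -> nat) a : R a a ->
  (forall x, R x x -> slt R (h x) a) ->
  (forall x y, slt R x y -> slt R (h x) (h y)) -> False.
Proof.
move=> Ra ha hh; suff H x : R x x -> ~ slt R (h x) x by apply: (H a Ra); apply: ha.
elim/wo_ind => {}x Rx IH lt; exact: (IH _ lt (hh _ _ lt)).
Qed.

Lemma slt_below a x y : slt (below R a) x y <-> slt R x y /\ slt R y a.
Proof.
split=> [[[xy xa nxa ya nya] nxy]|[[xy nxy] [ya nya]]]; first by [].
split=> //; split=> //; first exact: wo_trans xy ya.
by move=> xa; apply: nxy; apply: wo_anti => //; rewrite xa.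
Qed.

Lemma field_below a x : Defs.field (below R a) x <-> slt R x a.
Proof.
split=> [[]|[xa nxa]] //; split=> //.
by have [] := wo_field xa.
Qed.

Lemma wo_below a : well_ordering (below R a).
Proof.
split=> [x y [xy xa nxa ya nya]|x y z [xy xa nxa ya nya] [yz _ _ za nza]|
         x y [xy _ _ _ _] [yx _ _ _ _]|A Af [x Ax]].
- by have [Rx Ry] := wo_field xy.
- by split=> //; apply: wo_trans xy yz.
- exact: wo_anti.
- have Aa y : A y -> slt R y a by move=> /Af /field_below.
  have [|z [Rz Az zP]] := @wo_least A.
    by exists x => //; have [xa _] := Aa _ Ax; have [] := wo_field xa.
  exists z => // y Ay; have [ya nya] := Aa _ Ay; have [za nza] := Aa _ Az.
  by split=> //; apply: zP => //; have [] := wo_field ya.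
Qed.

End WellOrdering.

Lemma emb_trans S R T : emb R S -> emb S T -> emb R T.
Proof.
move=> [h h1 h2] [g g1 g2]; exists (g \o h) => [x Rx|x y xy] /=; first exact/g1/h1.
exact/g2/h2.
Qed.

Lemma same_type_emb R S : same_type R S -> well_ordering R -> emb R S.
Proof.
move=> [f [fm fi _] fP] wR; exists f => [x Rx|x y [xy nxy]]; first exact: fm.
have [Rx Ry] := wo_field wR xy; split; first exact/fP.
by move=> /fi fxy; apply: nxy; apply: fxy; rewrite inE.
Qed.

Lemma emb_below S a : well_ordering S -> emb (below S a) S.
Proof.
move=> wS; exists id => [x /(field_below wS) [xa _]|x y /(slt_below wS) []] //.
by have [] := wo_field wS xa.
Qed.

Lemma type_lt_emb R S : type_lt R S -> well_ordering R -> well_ordering S -> emb R S.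
Proof.
move=> [a _ Ra] wR wS; apply: emb_trans (emb_below a wS).
exact: same_type_emb.
Qed.

Lemma type_le_emb R S : type_le R S -> well_ordering R -> well_ordering S -> emb R S.
Proof. by move=> [/type_lt_emb|/same_type_emb H] // wR _; apply: H. Qed.

Lemma emb_not_lt R S : emb R S -> well_ordering R -> well_ordering S -> ~ type_lt S R.
Proof.
move=> [h h1 h2] wR wS [a Ra /same_type_emb/(_ wS) [f f1 f2]].
apply: (@no_bounded_self_emb R wR (f \o h) a Ra) => [x Rx|x y xy].
  exact/field_below/f1/h1.
by have /f2/(slt_below wR) [] := h2 _ _ xy.
Qed.

Lemma same_typeI R S f : well_ordering R -> well_ordering S ->
  (forall x, R x x -> S (f x) (f x)) ->
  (forall y, S y y -> exists2 x, R x x & f x = y) ->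
  (forall x y, slt R x y -> slt S (f x) (f y)) -> same_type R S.
Proof.
move=> wR wS fm fs f2; exists f; last first.
  move=> x y Rx Ry; have [xy|->|yx] := wo_total wR Rx Ry.
  - by split=> _; [have [] := f2 _ _ xy | case: xy].
  - by split=> _ //; apply: fm.
  - split=> [xy|fxy]; case: yx => yx nyx; exfalso.
      by apply: nyx; apply: (wo_anti wR).
    by have [fyx] := f2 _ _ (conj yx nyx); apply; apply: (wo_anti wS).
split=> [x Rx|x y|y Sy]; first exact: fm.
  rewrite !inE => Rx Ry fxy; have [xy|//|yx] := wo_total wR Rx Ry.
    by have [_] := f2 _ _ xy.
  by have [_ []] := f2 _ _ yx.
by have [x Rx <-] := fs _ Sy; exists x.
Qed.

Definition bisim (R S B : nat -> nat -> Prop) : Prop :=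
  forall x y, B x y -> [/\ R x x, S y y,
    forall x', slt R x' x -> exists2 y', slt S y' y & B x' y' &
    forall y', slt S y' y -> exists2 x', slt R x' x & B x' y'].

(* [matched R S x y] says that [x] and [y] have the same rank. *)
Definition matched (R S : nat -> nat -> Prop) x y : Prop :=
  exists2 B, bisim R S B & B x y.

Lemma matched_sym R S x y : matched R S x y -> matched S R y x.
Proof.
move=> [B bB Bxy]; exists (fun y x => B x y) => // {Bxy}y {}x /bB [Rx Sy fo ba].
by split=> // [z /ba [t]|z /fo [t]]; exists t.
Qed.

Lemma matched_bisim R S : bisim R S (matched R S).
Proof.
move=> x y [B bB /bB [Rx Sy fo ba]]; split=> // [z /fo [t]|z /ba [t]]; exists t => //;
  by exists B.
Qed.

(** Adding the pair to [matched] yields a bisimulation again. *)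
Lemma matchedI R S x y : R x x -> S y y ->
  (forall x', slt R x' x -> exists2 y', slt S y' y & matched R S x' y') ->
  (forall y', slt S y' y -> exists2 x', slt R x' x & matched R S x' y') ->
  matched R S x y.
Proof.
move=> Rx Sy fo ba; exists (fun u v => (u = x /\ v = y) \/ matched R S u v); last by left.
move=> u v [[-> ->]|/matched_bisim [Ru Sv fo' ba']]; split=> //.
- by move=> z /fo [t]; exists t => //; right.
- by move=> z /ba [t]; exists t => //; right.
- by move=> z /fo' [t]; exists t => //; right.
- by move=> z /ba' [t]; exists t => //; right.
Qed.

Lemma matched_fun R S x y y' : well_ordering R -> well_ordering S ->
  matched R S x y -> matched R S x y' -> y = y'.
Proof.
move=> wR wS xy; have [Rx _ _ _] := matched_bisim xy.
elim/(wo_ind wR): Rx y y' xy => {}x Rx IH.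
have H y y' : slt S y y' -> matched R S x y -> matched R S x y' -> False.
  move=> lt /matched_bisim [_ _ fo _] /matched_bisim [_ _ _ ba].
  have [x' x'x x'y] := ba _ lt; have [y'' lt' x'y''] := fo _ x'x.
  by have [_] := lt'; apply; apply: IH x'y'' x'y.
move=> y y' xy xy'; have [_ Sy _ _] := matched_bisim xy.
have [_ Sy' _ _] := matched_bisim xy'.
have [lt|//|lt] := wo_total wS Sy Sy'; first by case: (H _ _ lt xy xy').
by case: (H _ _ lt xy' xy).
Qed.

Lemma matched_lt R S x x' y y' : well_ordering R -> well_ordering S ->
  matched R S x y -> matched R S x' y' -> slt R x x' -> slt S y y'.
Proof.
move=> wR wS xy /matched_bisim [_ _ fo _] /fo [z zy' xz].
by rewrite (matched_fun wR wS xy xz).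
Qed.

Lemma matched_map R S : well_ordering R -> well_ordering S ->
  (forall x, R x x -> exists y, matched R S x y) ->
  exists f, [/\ forall x, R x x -> S (f x) (f x),
    forall x, R x x -> matched R S x (f x),
    forall x y, slt R x y -> slt S (f x) (f y) &
    forall x y, matched R S x y -> R x x /\ y = f x].
Proof.
move=> wR wS tot.
have /choice [f fP] : forall x, exists y, R x x -> matched R S x y.
  move=> x; have [/tot [y xy]|nx] := EM (R x x); first by exists y.
  by exists 0 => /nx.
have fm x : R x x -> S (f x) (f x) by move=> /fP /matched_bisim [].
have f2 x y : slt R x y -> slt S (f x) (f y).
  move=> xy; case: (xy) => xy' _; have [Rx Ry] := wo_field wR xy'.
  exact: (matched_lt wR wS (fP _ Rx) (fP _ Ry)).
have fE x y : matched R S x y -> R x x /\ y = f x.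
  move=> xy; have [Rx _ _ _] := matched_bisim xy; split=> //.
  exact: (matched_fun wR wS xy (fP _ Rx)).
by exists f.
Qed.

Lemma matched_same_type R S : well_ordering R -> well_ordering S ->
  (forall x, R x x -> exists y, matched R S x y) ->
  (forall y, S y y -> exists x, matched R S x y) -> same_type R S.
Proof.
move=> wR wS /(matched_map wR wS) [f [fm _ f2 fE]] onto.
apply: (same_typeI (f := f)) => // y /onto [x /fE [Rx ->]].
by exists x.
Qed.

(** The matched points of [S] form a proper initial segment, bounded by the least unmatched point
    [a]. *)
Lemma matched_type_lt R S y0 : well_ordering R -> well_ordering S ->
  (forall x, R x x -> exists y, matched R S x y) ->
  S y0 y0 -> (~ exists x, matched R S x y0) -> type_lt R S.
Proof.
move=> wR wS /(matched_map wR wS) [f [fm fP f2 fE]] Sy0 ny0.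
have [|a [Sa na aP]] := wo_least wS (A := fun y => ~ exists x, matched R S x y).
  by exists y0.
have fa x : R x x -> slt S (f x) a.
  move=> Rx; have [//|fxa|lt] := wo_total wS (fm x Rx) Sa.
    by case: na; exists x; rewrite -fxa; apply: fP.
  have [_ _ _ /(_ _ lt) [x' _ x'a]] := matched_bisim (fP _ Rx).
  by case: na; exists x'.
exists a => //; apply: (same_typeI (f := f)) => //.
- exact: wo_below.
- by move=> x Rx; apply/field_below => //; apply: fa.
- move=> y /(field_below wS) [ya nya]; have [Sy _] := wo_field wS ya.
  have [[x /fE [Rx ->]]|ny] := EM (exists x, matched R S x y); first by exists x.
  by case: nya; apply: (wo_anti wS) => //; apply: aP.
- move=> x y xy; apply/slt_below => //; split; first exact: f2.
  by case: (xy) => xy' _; have [_ Ry] := wo_field wR xy'; apply: fa.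
Qed.

(** If both orderings had unmatched points, all predecessors of the least ones [a] and [b] would be
    matched among each other, and then so would [a] and [b]. *)
Lemma type_comparable R S : well_ordering R -> well_ordering S ->
  type_le R S \/ type_lt S R.
Proof.
move=> wR wS.
have [tot|/existsNP [x0 /not_implyP [Rx0 nx0]]] :=
    EM (forall x, R x x -> exists y, matched R S x y).
  left; have [onto|/existsNP [y0 /not_implyP [Sy0 ny0]]] :=
    EM (forall y, S y y -> exists x, matched R S x y).
    by right; apply: matched_same_type.
  by left; apply: matched_type_lt Sy0 ny0.
right; have [|a [Ra na aP]] := wo_least wR (A := fun x => ~ exists y, matched R S x y).
  by exists x0.
have dom x : slt R x a -> exists y, matched R S x y.
  move=> [xa nxa]; apply: contrapT => nx; apply: nxa; apply: (wo_anti wR) => //.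
  by apply: aP => //; have [] := wo_field wR xa.
have onto y : S y y -> exists x, matched S R y x.
  move=> Sy; apply: contrapT => ny.
  have [|b [Sb nb bP]] := wo_least wS (A := fun y => ~ exists x, matched S R y x).
    by exists y.
  have ran z : slt S z b -> exists x, matched S R z x.
    move=> [zb nzb]; apply: contrapT => nz; apply: nzb; apply: (wo_anti wS) => //.
    by apply: bP => //; have [] := wo_field wS zb.
  apply: (na); exists b; apply: matchedI => // [x xa|z zb].
    have [z xz] := dom _ xa; exists z => //.
    have [_ Sz _ ba] := matched_bisim xz.
    have [//|zb|lt] := wo_total wS Sz Sb.
      by case: (nb); exists x; rewrite -zb; apply: matched_sym.
    by have [x' _ x'b] := ba _ lt; case: (nb); exists x'; apply: matched_sym.
  have [x /matched_sym xz] := ran _ zb; exists x => //.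
  have [Rx _ fo _] := matched_bisim xz.
  have [//|xa|lt] := wo_total wR Rx Ra.
    by case: (na); exists z; rewrite -xa.
  by have [z' _ az'] := fo _ lt; case: (na); exists z'.
apply: matched_type_lt Ra _ => //.
by move=> [y /matched_sym ya]; apply: na; exists y.
Qed.

Lemma type_ltP R S : well_ordering R -> well_ordering S -> type_lt R S <-> ~ emb S R.
Proof.
move=> wR wS; split=> [RS SR|N]; first exact: emb_not_lt SR wS wR RS.
by have [/type_le_emb H|//] := type_comparable wS wR; case: N; apply: H.
Qed.

Lemma type_leP R S : well_ordering R -> well_ordering S -> type_le R S <-> emb R S.
Proof.
move=> wR wS; split=> [RS|RS]; first exact: type_le_emb.
by have [//|/(emb_not_lt RS wR wS)] := type_comparable wR wS.
Qed.

Lemma same_typeP R S : well_ordering R -> well_ordering S ->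
  same_type R S <-> emb R S /\ emb S R.
Proof.
move=> wR wS; split=> [RS|[RS SR]]; last first.
  by have [[/(type_ltP wR wS)|//]|/(type_ltP wS wR)] := type_comparable wR wS.
split; first exact: same_type_emb.
apply: contrapT => /(type_ltP wR wS) [a Sa Ra].
have [h h1 h2] := same_type_emb Ra wR.
have [f [fm fi fs] fP] := RS.
have [g gP] : exists g : nat -> nat, forall y, S y y -> R (g y) (g y) /\ f (g y) = y.
  have /choice [g gP] : forall y, exists x, S y y -> R x x /\ f x = y.
    move=> y; have [Sy|nSy] := EM (S y y); last by exists 0 => /nSy.
    by have [x Rx fx] := fs _ Sy; exists x.
  by exists g.
apply: (@no_bounded_self_emb S wS (h \o g) a Sa) => [y /gP [Rg _]|y z yz].
  exact/field_below/h1.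
have [yz' nyz] := yz; have [/gP [Ry fy] /gP [Rz fz]] := wo_field wS yz'.
have : slt R (g y) (g z).
  by split; [apply/fP => //; rewrite fy fz | move=> E; apply: nyz; rewrite -fy E].
by move=> /h2 /(slt_below wS) [].
Qed.

Lemma emb_total R S : well_ordering R -> well_ordering S -> emb R S \/ emb S R.
Proof.
move=> wR wS; have [/type_le_emb H|/type_lt_emb H] := type_comparable wR wS.
  by left; apply: H.
by right; apply: H.
Qed.

Lemma ltn_pr x y : pr x y < pr x y.+1.
Proof.
rewrite /pr; have := Cantor.to_nat_spec x y; have := Cantor.to_nat_spec x y.+1.
by nia.
Qed.

(** * The ordinal omega_1^X *)

Lemma recursive_below X R a : recursive_in X R -> recursive_in X (below R a).
Proof.
move=> /turing_leP hR; apply/turing_leP.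
set Z := [set n | R (pr1 n) (pr2 n)] in hR.
have : computes (eq (chi X)) (fun _ n => [&& chi Z n != 0,
    chi Z (pr (pr1 n) a) != 0, pr1 n != a, chi Z (pr (pr2 n) a) != 0 & pr2 n != a]).
  by computes_tac.
apply: computes_ext => f _ n; rewrite !chi_neq0 /Z /= !prE /chi; congr nat_of_bool.
apply/idP/asboolP => /=.
  by move=> /and5P [/asboolP ? /asboolP ? /eqP ? /asboolP ? /eqP ?].
by move=> [? ? ? ? ?]; apply/and5P; split; try exact/asboolP; apply/eqP.
Qed.

(** Up to isomorphism [W] is [R] or one of its initial segments, and these remain recursive in
    [X]. *)
Lemma recursive_type_emb X R W : recursive_in X R -> well_ordering R ->
  well_ordering W -> emb W R -> recursive_type X W.
Proof.
move=> hR wR wW /(type_leP wW wR) [[a Ra WR]|WR].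
  exists (below R a); split; [exact: recursive_below|exact: wo_below|].
  by apply/same_typeP => //; [exact: wo_below|have [] := (same_typeP wW (wo_below wR a)).1 WR].
by exists R; split=> //; apply/same_typeP => //; have [] := (same_typeP wW wR).1 WR.
Qed.

Lemma recursive_typeP X W : well_ordering W -> recursive_type X W <->
  exists R, [/\ recursive_in X R, well_ordering R & emb W R].
Proof.
move=> wW; split=> [[R [hR wR RW]]|[R [hR wR WR]]]; last exact: recursive_type_emb WR.
by exists R; split=> //; have [] := (same_typeP wR wW).1 RW.
Qed.

Lemma recursive_type_le X V W : well_ordering V -> well_ordering W -> emb V W ->
  recursive_type X W -> recursive_type X V.
Proof.
move=> wV wW VW /(recursive_typeP _ wW) [R [hR wR WR]]; apply/recursive_typeP => //.
by exists R; split=> //; apply: emb_trans VW WR.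
Qed.

Lemma set0_le X : set0 <=_T X.
Proof.
apply/turing_leP; apply: (computes_ext _ (computes_const _ 0)) => f _ n.
by rewrite /chi; case: asboolP.
Qed.

Lemma recursive_type_set0 X W : recursive_type set0 W -> recursive_type X W.
Proof.
move=> [R [hR wR RW]]; exists R; split=> //.
exact: turing_le_trans hR (set0_le X).
Qed.

Lemma is_omega1P X W : is_omega1 X W <-> [/\ well_ordering W, ~ recursive_type X W &
  forall S, well_ordering S -> ~ recursive_type X S -> emb W S].
Proof.
split=> [[wW nW H]|[wW nW H]]; split=> // S wS nS; last exact/type_leP/H.
exact/(type_leP wW wS)/H.
Qed.

Definition indexed (X : set nat) (e x y : nat) : Prop := Phi (chi X) e (pr x y) 1.

Lemma indexedP X R : recursive_in X R -> exists e, R = indexed X e.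
Proof.
move=> [e eP]; exists e; apply/funext => x; apply/funext => y; apply/propext.
rewrite /indexed; have := eP (pr x y); rewrite /chi /= !prE.
case: asboolP => Rxy H; split=> // H'; by have := Phi_fun H H'.
Qed.

(* The sum of omega copies of every X-recursive well-ordering. A second copy lies
   above the first, so an X-recursive presentation of the sum would embed it below
   one of its own points. *)
Definition wo_sum (X : set nat) (u v : nat) : Prop :=
  let e := pr1 (pr1 u) in let d := pr1 (pr1 v) in
  [/\ well_ordering (indexed X e), well_ordering (indexed X d),
      indexed X e (pr2 u) (pr2 u), indexed X d (pr2 v) (pr2 v) &
      pr1 u < pr1 v \/ (pr1 u = pr1 v /\ indexed X e (pr2 u) (pr2 v))].

Lemma pr_ext u v : pr1 u = pr1 v -> pr2 u = pr2 v -> u = v.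
Proof. by move=> E1 E2; rewrite -(prK u) -(prK v) E1 E2. Qed.

Lemma wo_wo_sum X : well_ordering (wo_sum X).
Proof.
split.
- move=> u v [wu wv Ru Rv _]; rewrite /Defs.field /wo_sum /=.
  by split; split=> //; right.
- move=> u v w [wu wv Ru Rv uv] [_ ww _ Rw vw]; split=> //.
  case: uv => [uv|[uv Ruv]]; case: vw => [vw|[vw Rvw]].
  + by left; apply: ltn_trans uv vw.
  + by left; rewrite -vw.
  + by left; rewrite uv.
  + right; split; first by rewrite uv.
    by apply: (wo_trans wu) Ruv _; rewrite uv.
- move=> u v [wu _ _ _ uv] [_ _ _ _ vu].
  case: uv => [uv|[uv Ruv]]; case: vu => [vu|[vu Rvu]]; try lia.
  by apply: pr_ext => //; apply: (wo_anti wu) => //; rewrite uv.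
- move=> A Af [u0 Au0].
  have [m [u Au um] mmin] : exists2 m, (exists2 u, A u & pr1 u = m) &
      forall v, A v -> m <= pr1 v.
    have ex : exists m, `[< exists2 u, A u & pr1 u = m >].
      by exists (pr1 u0); apply/asboolP; exists u0.
    case: (ex_minnP ex) => m /asboolP hm mmin; exists m => // v Av.
    by apply: mmin; apply/asboolP; exists v.
  have [wu _ Ru _ _] := Af _ Au.
  have [|x [Rx [v [Av vm vx]] xP]] := wo_least wu
      (A := fun x => exists v, [/\ A v, pr1 v = m & pr2 v = x]).
    by exists (pr2 u) => //; exists u.
  exists v => // w Aw; have [ww _ Rw _ _] := Af _ Aw; have [wv _ Rv _ _] := Af _ Av.
  split=> //; have := mmin _ Aw; rewrite leq_eqVlt => /orP [/eqP mw|mw]; last first.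
    by left; rewrite vm.
  right; split; first by rewrite vm.
  rewrite vm -um vx; apply: xP; last by exists w.
  by rewrite um mw.
Qed.

Lemma wo_sum_not_recursive X : ~ recursive_type X (wo_sum X).
Proof.
move=> /(recursive_typeP _ (wo_wo_sum X)) [R [hR wR [h h1 h2]]].
have [e RE] := indexedP hR; rewrite RE in wR h1 h2.
pose g x := pr (pr e 0) x.
have gP j x : indexed X e x x -> wo_sum X (pr (pr e j) x) (pr (pr e j) x).
  by rewrite /wo_sum !prE => Rx; split=> //; right.
(* The bound in copy 1 requires the ordering [e] to be nonempty: it contains the image under [h] of
   a point of the sum, taken from a one-point ordering. *)
have [x0 Rx0] : exists x0, indexed X e x0 x0.
  have hS : recursive_in X (fun x y => x = 0 /\ y = 0).
    apply/turing_leP.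
    have : computes (eq (chi X)) (fun _ n => (pr1 n == 0) && (pr2 n == 0)) by computes_tac.
    apply: computes_ext => f _ n; rewrite /chi; congr nat_of_bool.
    apply/idP/asboolP => /=; first by move=> /andP [/eqP ? /eqP ?].
    by move=> [-> ->].
  have [d dE] := indexedP hS.
  have wS : well_ordering (indexed X d).
    rewrite -dE; split=> [x y [-> ->]|x y z [-> _] [_ ->]|x y [-> ->]|A Af [x Ax]] //.
    exists x => // y Ay; have [-> _] := Af _ Ax; by have [-> _] := Af _ Ay.
  exists (h (pr (pr d 0) 0)); apply: h1; rewrite /Defs.field /wo_sum /= !prE -dE.
  by rewrite -dE in wS; split=> //; right.
apply: (@no_bounded_self_emb (wo_sum X) (wo_wo_sum X) (g \o h) (pr (pr e 1) x0)).
- exact: gP.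
- move=> u Ru; have Rh := h1 _ Ru; split.
    rewrite /wo_sum /g /= !prE; split=> //; left.
    exact: ltn_pr.
  by move=> /pr_inj [/pr_inj []].
- move=> u v uv; have [Ruv nuv] := h2 _ _ uv; have [Ru Rv] := wo_field wR Ruv.
  split; first by rewrite /wo_sum /g /= !prE; split=> //; right.
  by move=> /pr_inj [_].
Qed.

(** The least initial segment of [wo_sum X] that is not of X-recursive type, or the whole sum when
    there is none. *)
Lemma is_omega1_exists X : exists W, is_omega1 X W.
Proof.
pose Z := wo_sum X; have wZ : well_ordering Z := wo_wo_sum X.
have nZ : ~ recursive_type X Z := @wo_sum_not_recursive X.
have [[a0 Za0 na0]|Nb] := EM (exists2 a, Z a a & ~ recursive_type X (below Z a)).
  have [|a [Za na aP]] := wo_least wZ (A := fun a => ~ recursive_type X (below Z a)).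
    by exists a0.
  have wa := wo_below wZ a.
  exists (below Z a); apply/is_omega1P; split=> // S wS nS.
  apply: contrapT => /(type_ltP wS wa) [b /(field_below wZ) [ba nba] Sb].
  have [Zb _] := wo_field wZ ba.
  apply: nba; apply: (wo_anti wZ ba); apply: aP => // rb; apply: nS.
  apply: recursive_type_le rb => //; first exact: wo_below.
  apply: emb_trans (same_type_emb Sb wS) _; exists id => [x|x y].
    by move=> [[? _ _ _ _] [? _ _ _ _] ? _ _]; split.
  by move=> [[[? _ _ _ _] [? _ _ _ _] ? [? _ _ _ _] ?] ?]; split.
exists Z; apply/is_omega1P; split=> // S wS nS.
apply: contrapT => /(type_ltP wS wZ) [b Zb Sb]; apply: Nb; exists b => // rb; apply: nS.
apply: recursive_type_le rb => //; first exact: wo_below.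
exact: same_type_emb Sb wS.
Qed.

Lemma omega1_dichotomy X : omega1_eq X set0 \/ omega1_lt set0 X.
Proof.
have [U] := is_omega1_exists set0; have [W] := is_omega1_exists X.
move=> hW hU; have [wW nW Wmin] := (is_omega1P _ _).1 hW.
have [wU nU Umin] := (is_omega1P _ _).1 hU.
have [WU|/(type_ltP wU wW) lt] := EM (emb W U); last by right; exists U, W.
(* [U] also represents omega_1^X: were it of X-recursive type, so would be [W]; and it embeds into
   [W], which is not of recursive type. *)
left; exists U => //; apply/is_omega1P; split=> //.
  by move=> /(recursive_type_le wW wU WU).
move=> S wS nS; apply: emb_trans (Wmin _ wS nS); apply: Umin => //.
by move=> /(@recursive_type_set0 X).
Qed.

Lemma omega1_exclusive X : omega1_eq X set0 -> omega1_lt set0 X -> False.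
Proof.
move=> [W /is_omega1P [wW nW _] /is_omega1P [_ _ Wmin]].
move=> [U [V [/is_omega1P [wU nU _] /is_omega1P [wV _ Vmin] UV]]].
have VU : emb V U := emb_trans (Vmin _ wW nW) (Wmin _ wU nU).
exact: emb_not_lt VU wV wU UV.
Qed.

(** The type omega_1^CK is then X-recursive, and a presentation of a type at least that large
    receives every recursive well-ordering. *)
Lemma omega1_lt_emb X : omega1_lt set0 X ->
  exists R, [/\ recursive_in X R, well_ordering R &
    forall S, recursive_in set0 S -> well_ordering S -> emb S R].
Proof.
move=> [U [V [/is_omega1P [wU nU _] /is_omega1P [wV _ Vmin] UV]]].
have /(recursive_typeP _ wU) [R [hR wR UR]] : recursive_type X U.
  by apply: contrapT => /(Vmin _ wU)/emb_not_lt/(_ wV wU UV).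
exists R; split=> // S hS wS; have [//|RS] := emb_total wS wR.
case: nU; apply: recursive_type_emb hS wS wU _; exact: emb_trans UR RS.
Qed.

(** The common bound [a] shows that [R] is not of recursive type: a recursive presentation would
    send [R] into itself below [a]. *)
Lemma omega1_ltI X R a : recursive_in X R -> well_ordering R -> R a a ->
  (forall S, recursive_in set0 S -> well_ordering S ->
     exists2 h : nat -> nat, forall x, S x x -> slt R (h x) a &
       forall x y, slt S x y -> slt R (h x) (h y)) ->
  omega1_lt set0 X.
Proof.
move=> hR wR Ra HR.
have [U hU] := is_omega1_exists set0; have [V hV] := is_omega1_exists X.
have [wU nU Umin] := (is_omega1P _ _).1 hU.
have [wV nV _] := (is_omega1P _ _).1 hV.
exists U, V; split=> //; apply/(type_ltP wU wV) => VU; apply: nV.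
apply: (recursive_type_le wV wU VU); apply/recursive_typeP => //; exists R; split=> //.
have [//|RU] := emb_total wU wR.
apply: Umin => // /(recursive_typeP _ wR) [S [hS wS [g g1 g2]]].
have [h h1 h2] := HR S hS wS.
apply: (@no_bounded_self_emb R wR (h \o g) a Ra) => [x Rx|x y xy] /=.
  exact/h1/g1.
exact/h2/g2.
Qed.

(** * The Kleene-Brouwer ordering *)

Fixpoint kb (s t : seq nat) : bool :=
  match s, t with
  | [::], _ => false
  | _ :: _, [::] => true
  | x :: s', y :: t' => (x < y) || (x == y) && kb s' t'
  end.

Lemma kb_irr s : kb s s = false.
Proof. by elim: s => //= x s ->; rewrite ltnn eqxx. Qed.

Lemma kb_trans t s u : kb s t -> kb t u -> kb s u.
Proof.
elim: s t u => [//|x s IH] [|y t] [|z u] //=.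
case/orP=> [xy|/andP [/eqP -> st]]; case/orP=> [yz|/andP [/eqP <- tu]].
- by rewrite (ltn_trans xy yz).
- by rewrite xy.
- by rewrite yz.
- by rewrite eqxx (IH _ _ st tu) orbT.
Qed.

Lemma kb_cat s t u : kb (s ++ t) (s ++ u) = kb t u.
Proof. by elim: s => //= x s ->; rewrite ltnn eqxx. Qed.

Lemma kb_rcons s x : kb (rcons s x) s.
Proof. by rewrite -cats1 -[X in kb _ X]cats0 kb_cat. Qed.

(** A form with bounded quantifiers, for computability: [i] is the first difference or the end of
    [t]. *)
Lemma kbE s t : kb s t = has (fun i =>
  all (fun j => (j < size t) && (nth 0 s j == nth 0 t j)) (iota 0 i) &&
  ((size t <= i) || (nth 0 s i < nth 0 t i))) (iota 0 (size s)).
Proof.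
have iotaS n : iota 1 n = map S (iota 0 n) by rewrite -[1]/(1 + 0) iotaDl.
elim: s t => [//|x s IH] [|y t] //=.
rewrite iotaS has_map IH; congr orb.
have [->|xy] := eqVneq x y; last first.
  by apply/esym/negbTE/hasPn => i _ /=; rewrite (negbTE xy).
apply: eq_has => i /=; rewrite eqxx /= iotaS all_map; congr andb.
Qed.

Definition kb_order (T : nat -> bool) (x y : nat) : Prop :=
  [/\ T x, T y & x = y \/ kb (dec x) (dec y)].

Lemma closed_tree_cat T s u : closed_tree T -> T (s ++ u) -> T s.
Proof.
by move=> cl; elim/last_ind: u => [|u k IH]; rewrite ?cats0 // -rcons_cat => /cl.
Qed.

(** Bar induction: take the least next entry [k] among the proper extensions of [s] in [A] and
    recurse below it. Extensions precede [s], so [s] itself serves only when there are none. *)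
Lemma bar_kb_least T s (A : seq nat -> Prop) : closed_tree T -> bar T s ->
  (forall t, A t -> T t) -> (exists u, A (s ++ u)) ->
  exists2 u, A (s ++ u) & forall v, A (s ++ v) -> v = u \/ kb u v.
Proof.
move=> cl b AT; elim: b => {}s _ IH [u0 Au0].
have [[k0 Ak0]|N] := EM (exists k, exists u, A (s ++ k :: u)); last first.
  have nil v : A (s ++ v) -> v = [::].
    by case: v => // k v Av; case: N; exists k, v.
  exists [::]; first by rewrite -(nil _ Au0).
  by move=> v /nil ->; left.
have ex : exists k, `[< exists u, A (s ++ k :: u) >] by exists k0; apply/asboolP.
case: (ex_minnP ex) => k /asboolP [u Au] kmin.
have Tk : T (rcons s k) by apply: (closed_tree_cat (u := u)) => //; rewrite cat_rcons; apply: AT.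
have [|w Aw wP] := IH k Tk; first by exists u; rewrite cat_rcons.
rewrite cat_rcons in Aw; exists (k :: w) => // -[|j v] Av; first by right.
have : k <= j by apply: kmin; apply/asboolP; exists v.
rewrite leq_eqVlt => /orP [/eqP kj|kj]; last by right; rewrite /= kj.
rewrite -kj -cat_rcons in Av; rewrite -kj /= eqxx /=.
by have [->|H] := wP _ Av; [left | right; rewrite H orbT].
Qed.

Lemma wo_kb_order (T : nat -> bool) : closed_tree (fun s => T (enc s)) -> wf_tree (fun s => T (enc s)) ->
  well_ordering (kb_order T).
Proof.
move=> cl wf; split.
- by move=> x y [Tx Ty _]; split; split=> //; left.
- move=> x y z [Tx Ty [->|xy]] [_ Tz [<-|yz]]; split=> //; [by left|by right|by right|].
  by right; apply: kb_trans xy yz.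
- move=> x y [_ _ [//|xy]] [_ _ [//|yx]].
  by have := kb_trans xy yx; rewrite kb_irr.
- move=> A Af [x Ax].
  have [||u Au uP] := bar_kb_least (s := [::]) (A := fun t => A (enc t)) cl (wf_tree_bar cl wf).
  + by move=> t /Af [].
  + by exists (dec x); rewrite decK.
  + exists (enc u) => // y Ay; have [Ty _ _] := Af _ Ay; have [Tu _ _] := Af _ Au.
    split=> //; have [|yu|uy] := uP (dec y); first by rewrite decK.
      by left; rewrite -yu decK.
    by right; rewrite encK.
Qed.

Lemma recursive_kb_order X (T : nat -> bool) : computes (eq (chi X)) (fun _ n => T n) ->
  recursive_in X (kb_order T).
Proof.
move=> hT; apply/turing_leP.
have hc a : computes (eq (chi X)) a -> computes (eq (chi X)) (fun f x => T (a f x)).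
  exact: computes_comp hT.
have : computes (eq (chi X)) (fun _ n => [&& T (pr1 n), T (pr2 n) &
    (pr1 n == pr2 n) || has (fun i =>
      all (fun j => (j < slen (pr2 n)) && (lk (pr1 n) j == lk (pr2 n) j)) (iota 0 i) &&
      ((slen (pr2 n) <= i) || (lk (pr1 n) i < lk (pr2 n) i))) (iota 0 (slen (pr1 n)))]).
  by computes_tac; apply: hc; computes_tac.
apply: computes_ext => f _ n; rewrite /chi; congr nat_of_bool.
rewrite -(kbE (dec (pr1 n)) (dec (pr2 n))).
apply/and3P/asboolP => /= [[Tx Ty xy]|[Tx Ty xy]]; split=> //.
  by case/orP: xy => [/eqP|]; [left|right].
by case: xy => [->|->]; rewrite ?eqxx ?orbT.
Qed.

Lemma kb_order_rcons (T : nat -> bool) s k : T (enc s) -> T (enc (rcons s k)) ->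
  slt (kb_order T) (enc (rcons s k)) (enc s).
Proof.
move=> Ts Tk; split; first by split=> //; right; rewrite !encK kb_rcons.
by move=> /enc_inj E; have := kb_rcons s k; rewrite E kb_irr.
Qed.

Lemma wo_no_descent R (r : nat -> nat) : well_ordering R ->
  (forall k, slt R (r k.+1) (r k)) -> False.
Proof.
move=> wR H; have Rr k : R (r k) (r k) by have [/(wo_field wR) []] := H k.
have [|x [_ [k <-] xP]] := wo_least wR (A := fun x => exists k, r k = x).
  by exists (r 0) => //; exists 0.
have [lt ne] := H k; apply: ne; apply: (wo_anti wR) => //.
by apply: xP => //; exists k.+1.
Qed.

(** * Reals X with omega_1^X > omega_1^CK *)

Lemma chi_bool (X : set nat) n : chi X n = (chi X n != 0).
Proof. by rewrite chi_neq0. Qed.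

Lemma recursive_tree_emb X T R : computes (eq (chi X)) (fun _ n => nat_of_bool (T n)) ->
  closed_tree (fun s => T (enc s)) -> wf_tree (fun s => T (enc s)) ->
  (forall S, recursive_in X S -> well_ordering S -> emb S R) ->
  exists h : nat -> nat, forall s k, T (enc s) -> T (enc (rcons s k)) ->
    slt R (h (enc (rcons s k))) (h (enc s)).
Proof.
move=> hT cl wf /(_ (kb_order T) (recursive_kb_order hT) (wo_kb_order cl wf)) [h _ h2].
by exists h => s k Ts Tk; apply/h2/kb_order_rcons.
Qed.

Lemma hyperjump_hyperjump_le X : omega1_lt set0 X ->
  hyperjump (hyperjump set0) <=_T hyperjump X.
Proof.
move=> /omega1_lt_emb [R [hR wR Remb]].
have [i0 i0P] := hyperjump_V set0.
set K := hyperjump set0; have [j jP] := hyperjump_V K.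
pose T := V_tree set0 i0.
have hT := computes_V_tree set0 i0; rewrite -/T in hT.
have clT n : closed_tree (fun s => T n (enc s)) := @V_tree_closed set0 i0 n.
have KP n : K n <-> wf_tree (fun s => T n (enc s)).
  by rewrite -[K n]i0P; apply: V_treeP.
pose Z := [set n | R (pr1 n) (pr2 n)].
(* Layout of [F]: tag 0 holds the declared membership of [n], tag 1 the ranks of the nodes of the
   tree of [n], tag 2 the values of a path through it. A number [y] with [bad F y] refutes one of
   these claims. *)
pose dom (F : nat -> nat) n := nat_of_bool (F (pr 0 n) != 0).
pose bad (F : nat -> nat) y :=
  if F (pr 0 (pr1 y)) != 0 then
    [&& T (pr1 y) (pr1 (pr2 y)), T (pr1 y) (pr (pr1 (pr2 y)) (pr2 (pr2 y))).+1 &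
      ~~ ((chi Z (pr (F (pr 1 (pr (pr1 y) (pr (pr1 (pr2 y)) (pr2 (pr2 y))).+1)))
                     (F (pr 1 (pr (pr1 y) (pr1 (pr2 y)))))) != 0) &&
          (F (pr 1 (pr (pr1 y) (pr (pr1 (pr2 y)) (pr2 (pr2 y))).+1)) !=
           F (pr 1 (pr (pr1 y) (pr1 (pr2 y))))))]
  else ~~ T (pr1 y) (enc (mkseq (fun k => F (pr 2 (pr (pr1 y) k))) (pr2 y))).
have bad_rank F n s k : ~~ bad F (pr n (pr (enc s) k)) -> F (pr 0 n) != 0 ->
    T n (enc s) -> T n (enc (rcons s k)) ->
    slt R (F (pr 1 (pr n (enc (rcons s k))))) (F (pr 1 (pr n (enc s)))).
  rewrite /bad !prE -enc_rcons => nb Fn Ts Tk.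
  move: nb; rewrite Fn Ts Tk negbK chi_neq0.
  by move=> /andP [/asboolP + /eqP ?]; rewrite /Z /= !prE.
have bad_path F n k : ~~ bad F (pr n k) -> F (pr 0 n) = 0 ->
    T n (enc (mkseq (fun k => F (pr 2 (pr n k))) k)).
  by rewrite /bad !prE => nb Fn; move: nb; rewrite Fn negbK.
(* Ranks along an infinite path would descend forever in [R], and a path contradicts
   well-foundedness, so an unrefuted [F] is right about every [n]. *)
have sound F : (forall y, ~~ bad F y) -> dom F = chi K.
  move=> H; apply/funext => n; rewrite /dom chi_bool chi_neq0; congr nat_of_bool.
  apply/idP/asboolP => [Fn|/KP wf].
    apply/KP => f; apply: contrapT => /forallNP N.
    have Tf k : T n (enc (mkseq f k)) by apply: contrapT; apply: N.
    apply: (@wo_no_descent R (fun k => F (pr 1 (pr n (enc (mkseq f k))))) wR) => k.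
    by rewrite mkseqS; apply: bad_rank => //; rewrite -?mkseqS.
  apply/negP => /eqP Fn; have [k] := wf (fun k => F (pr 2 (pr n k))).
  by apply; apply: bad_path.
(* Without an unrefuted [F] the quantification over [F] would be vacuous. Ranks come from the
   embeddings into [R], paths from ill-foundedness, and choice collects them over all [n]. *)
have [F0 F0P] : exists F, forall y, ~~ bad F y.
  have /choice [H HP] : forall n, exists h : nat -> nat,
      (K n -> forall s k, T n (enc s) -> T n (enc (rcons s k)) ->
         slt R (h (enc (rcons s k))) (h (enc s))) /\
      (~ K n -> forall k, T n (enc (mkseq h k))).
    move=> n; have [Kn|nK] := EM (K n).
      have [|h hP] := @recursive_tree_emb set0 (T n) R _ (clT n) ((KP n).1 Kn) Remb.
        by apply: (computes2 (R := fun _ n s => nat_of_bool (T n s)) hT); computes_tac.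
      by exists h.
    have [h /forallNP hP] : exists h, ~ exists k, ~ T n (enc (mkseq h k)).
      by apply/existsNP => wf; apply: nK; apply/KP.
    by exists h; split=> // _ k; apply: contrapT; apply: hP.
  exists (fun m => if pr1 m == 0 then chi K (pr2 m) else H (pr1 (pr2 m)) (pr2 (pr2 m))).
  move=> y; rewrite /bad !prE /= chi_neq0; case: asboolP => [Kn|nK]; last first.
    rewrite negbK; have [_ /(_ nK (pr2 y)) h] := HP (pr1 y).
    by rewrite (@eq_mkseq _ _ (H (pr1 y))) // => k; rewrite !prE.
  apply/negP => /and3P [T1 T2 /negP]; apply.
  have [/(_ Kn (dec (pr1 (pr2 y))) (pr2 (pr2 y))) + _] := HP (pr1 y).
  rewrite enc_rcons decK => /(_ T1 T2) [lt ne].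
  by apply/andP; split; [rewrite chi_neq0; apply/asboolP; rewrite /Z /= !prE | apply/eqP].
(* The even half of [f] is the candidate [F], the odd half the function variable of the Pi^1_1
   definition relative to O; [W] reassembles the oracle that this definition expects. *)
pose W (f : nat -> nat) := joinf (dom (fun m => f m.*2)) (fun m => f m.*2.+1).
pose P (f : nat -> nat) n y := bad (fun m => f m.*2) y || (run (W f) y j n != 0).
have [|i iP] := @V_search X P.
  set A := (fun g : nat -> nat => _).
  have hX : computes A (fun _ => chi X).
    by apply: (@computes_ext _ (fun g n => g n.*2)) => //; computes_tac.
  have hZ := computes_relative hX ((turing_leP _ _).1 hR); rewrite -/Z in hZ.
  have h0 := computes_relative hX ((turing_leP _ _).1 (set0_le X)).
  have hTA := computes_relative h0 hT.
  have hW : computes A (fun g q => W (fun n => g n.*2.+1) q).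
    by rewrite /W /joinf /dom; computes_tac.
  apply: computes_or; first by rewrite /bad; computes_tac.
  apply/computes_not/computes_eq0.
  have : computes A (fun g z => (fun f w => run f (pr1 w) (pr1 (pr2 w)) (pr2 (pr2 w)))
      (W (fun n => g n.*2.+1)) (pr (pr2 z) (pr j (pr1 z)))).
    apply: (computes_subst (B := fun _ => True) (G := fun g _ => W (fun n => g n.*2.+1))
      (P := fun _ z => z) (computes_run _)) => //; computes_tac.
    by apply: (computes_comp hW); computes_tac.
  by apply: computes_ext => g _ z; rewrite !prE.
suff -> : hyperjump K = V i X by apply: V_le_hyperjump.
apply: set_ext => n; rewrite iP -[hyperjump K n]jP; split=> H f.
  have [[y by_]|/forallNP N] := EM (exists y, bad (fun m => f m.*2) y).
    by exists y; rewrite /P by_.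
  have /sound E : forall y, ~~ bad (fun m => f m.*2) y by move=> y; apply/negP/N.
  have [y Hy] := (Phi_domP _ _ _).1 (H (fun m => f m.*2.+1)).
  by exists y; rewrite /P /W E Hy orbT.
have [y] := H (joinf F0 f); rewrite /P /W.
have -> : (fun m => joinf F0 f m.*2) = F0 by apply/funext => m; rewrite joinf_double.
have -> : (fun m => joinf F0 f m.*2.+1) = f by apply/funext => m; rewrite joinf_doubleS.
by rewrite (negbTE (F0P y)) (sound _ F0P) /= => Hy; apply/Phi_domP; exists y.
Qed.

(** The fuel is the witness carried by the later term [b]; the answer 2 is the output 1 shifted by
    one. *)
Definition descends (e a b : nat) : bool :=
  (run (chi set0) (pr2 b) e (pr (pr1 b) (pr1 a)) == 2) && (pr1 b != pr1 a).

(* The indices of r.e. relations without infinite descending sequences; a term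
   [pr x t] of a sequence consists of an element [x] and a witness [t]. *)
Definition founded_index : set nat :=
  [set e | forall f, exists i, ~~ descends e (f i) (f i.+1)].

Lemma founded_index_V : exists i, V i set0 = founded_index.
Proof.
have [|i iP] := @V_search set0 (fun f e i => ~~ descends e (f i) (f i.+1)).
  set A := (fun g : nat -> nat => _).
  have hX : computes A (fun _ => chi set0).
    by apply: (@computes_ext _ (fun g n => g n.*2)) => //; computes_tac.
  have hr := computes_relative hX (computes_run _).
  by rewrite /descends; computes_tac.
by exists i; apply: set_ext => n; rewrite iP.
Qed.

Lemma founded_indexP e : well_ordering (indexed set0 e) -> founded_index e.
Proof.
move=> wS f; apply: contrapT => /forallNP N.
apply: (@wo_no_descent _ (fun i => pr1 (f i)) wS) => i.
have /negP := N i; rewrite negbK => /andP [/eqP /run_sound H /eqP ne].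
by split.
Qed.

(** * Approximations of the jump, and the passage from O recursive in X' to omega_1^X >
    omega_1^CK *)

Definition jump_approx (X : set nat) (s q : nat) : bool :=
  has (fun t => run (chi X) t q q != 0) (iota 0 s).

Lemma jump_approx_sub X s q : jump_approx X s q -> jump X q.
Proof. by move=> /hasP [t _ Ht]; apply/Phi_domP; exists t. Qed.

Lemma jump_approx_limit X k : exists s, forall q, q < k -> jump X q -> jump_approx X s q.
Proof.
elim: k => [|k [s sP]]; first by exists 0.
have mono s1 s2 q : s1 <= s2 -> jump_approx X s1 q -> jump_approx X s2 q.
  move=> s12 /hasP [t]; rewrite mem_iota => ts Ht; apply/hasP; exists t => //.
  by rewrite mem_iota; lia.
have [/Phi_domP [t Ht]|nk] := EM (jump X k).
  exists (maxn s t.+1) => q; rewrite ltnS leq_eqVlt => /orP [/eqP -> _|qk Jq].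
    by apply/hasP; exists t => //; rewrite mem_iota; lia.
  by apply: mono (sP q qk Jq); apply: leq_maxl.
exists s => q; rewrite ltnS leq_eqVlt => /orP [/eqP ->|qk] // /sP; exact.
Qed.

(* A set recursive in the jump of [X] is Sigma_2(X): [u = pr k s] gives the
   length of a computation and a stage at which the approximation of the jump
   is already correct below [k]. *)
Lemma le_jump_Sigma2 X Q : Q <=_T jump X -> exists2 B : nat -> nat -> nat -> bool,
  computes (eq (chi X)) (fun _ z => B (pr1 z) (pr1 (pr2 z)) (pr2 (pr2 z))) &
  forall e, Q e <-> exists u, forall v, B e u v.
Proof.
move=> /turing_leP [c cP].
pose J s q := nat_of_bool (jump_approx X s q).
(* The variable [v] ranges over stages; it refutes [u] when it shows in the jump a number below
   [pr1 u] that is still missing at stage [pr2 u]. *)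
exists (fun e u v => (run (J (pr2 u)) (pr1 u) (encode c) e == 2) &&
  all (fun q => jump_approx X v q ==> jump_approx X (pr2 u) q) (iota 0 (pr1 u))).
  have hX : computes (eq (chi X)) (fun _ => chi X) by exists Oracle => f <-.
  have hr := computes_relative hX (computes_run _).
  have hj : computes (eq (chi X)) (fun _ z => jump_approx X (pr1 z) (pr2 z)).
    by rewrite /jump_approx; computes_tac.
  apply: computes_and; last by computes_tac.
  apply: computes_eqn; last exact: computes_const.
  have : computes (eq (chi X)) (fun _ z =>
      (fun f w => run f (pr1 w) (pr1 (pr2 w)) (pr2 (pr2 w)))
      (J (pr2 (pr1 (pr2 z)))) (pr (pr1 (pr1 (pr2 z))) (pr (encode c) (pr1 z)))).
    apply: (computes_subst (B := fun _ => True) (G := fun _ => J) (computes_run _)) => //.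
      by rewrite /J; computes_tac.
    by computes_tac.
  by apply: computes_ext => f _ z; rewrite !prE.
have JE k s : (forall q, q < k -> jump X q -> jump_approx X s q) ->
    forall q, q < k -> J s q = chi (jump X) q.
  move=> H q qk; rewrite /J /chi; congr nat_of_bool.
  by apply/idP/asboolP; [exact: jump_approx_sub | exact: H].
move=> e; split=> [Qe|[u uP]].
  have Pe : Phi (chi (jump X)) (encode c) e 1.
    by apply/PhiE; have := cP _ erefl e; rewrite /chi asboolT.
  have [k Hk] := (PhiP _ _ _ _).1 Pe; have [s sP] := jump_approx_limit X k.
  exists (pr k s) => v; rewrite !prE (run_use _ _ (JE k s sP)) Hk eqxx /=.
  apply/allP => q; rewrite mem_iota => /andP [_ qk]; apply/implyP => /jump_approx_sub.
  exact: sP.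
have H q : q < pr1 u -> jump X q -> jump_approx X (pr2 u) q.
  move=> qk /Phi_domP [t Ht]; have /andP [_ /allP/(_ q)] := uP t.+1.
  rewrite mem_iota => /(_ qk)/implyP; apply.
  by apply/hasP; exists t => //; rewrite mem_iota; lia.
have /andP [/eqP Hu _] := uP 0.
rewrite (run_use _ _ (JE _ _ H)) in Hu.
have /PhiE Qe := run_sound Hu; have := eval_fun Qe (cP _ erefl e).
by rewrite /chi; case: asboolP.
Qed.

Lemma hyperjump_le_jump X : hyperjump set0 <=_T jump X -> omega1_lt set0 X.
Proof.
move=> OX.
have : founded_index <=_T jump X.
  have [i <-] := founded_index_V.
  exact: turing_le_trans (V_le_hyperjump i set0) OX.
move=> /le_jump_Sigma2 [B hB BP].
(* Below the node [pr e u], the sequences that descend in the relation with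
   index [e] as long as [u] is not refuted as a witness for [founded_index e]. *)
pose node i s := B (pr1 (lk s 0)) (pr2 (lk s 0)) i &&
  ((i < 2) || descends (pr1 (lk s 0)) (lk s i.-1) (lk s i)).
pose T s := all (fun i => node i s) (iota 0 (slen s)).
have TP s : T (enc s) <-> forall i, i < size s -> node i (enc s).
  rewrite /T /slen encK; split=> [/allP H i iS|H].
    by apply: H; rewrite mem_iota.
  by apply/allP => i; rewrite mem_iota => /andP [_]; apply: H.
have node_rcons s k i : i < size s -> node i (enc (rcons s k)) = node i (enc s).
  move=> iS; rewrite /node !lk_enc !nth_rcons iS.
  have -> : 0 < size s by lia.
  by have -> : i.-1 < size s by lia.
have hT : computes (eq (chi X)) (fun _ s => nat_of_bool (T s)).
  have h0 := (turing_leP _ _).1 (set0_le X).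
  have hr := computes_relative h0 (computes_run _).
  have hB' := computes3 (R := fun _ a b c => nat_of_bool (B a b c)) hB.
  by rewrite /T /node /descends; computes_tac; apply: hB'; computes_tac.
have cl : closed_tree (fun s => T (enc s)).
  move=> s k /TP H; apply/TP => i iS; rewrite -(node_rcons s k i iS).
  by apply: H; rewrite size_rcons ltnW.
have wf : wf_tree (fun s => T (enc s)).
  move=> f; apply: contrapT => /forallNP N.
  have Nf i : node i (enc (mkseq f i.+1)).
    have /contrapT/TP := N i.+1; apply.
    by rewrite size_mkseq.
  have Qe : founded_index (pr1 (f 0)).
    apply/BP; exists (pr2 (f 0)) => v.
    by have := Nf v; rewrite /node lk_mkseq => /andP [].
  (* Entry 0 of the path is the pair of index and witness and entry 1 the first term, so the descent
     starts at entry 2 and the sequence of terms is shifted by one. *)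
  have [i] := Qe (fun i => f i.+1); have := Nf i.+2.
  by rewrite /node !lk_mkseq /= ltnSn leqnSn => /andP [_ ->].
have wR := wo_kb_order cl wf.
have Tnil : T (enc [::]) by [].
apply: (@omega1_ltI X (kb_order T) (enc [::])) => //; first exact: recursive_kb_order.
  by split=> //; left.
move=> S /indexedP [e ->] wS.
have [u uP] := (BP e).1 (founded_indexP wS).
(* The witness [u] is correct and never refuted, so the only constraint below [pr e u] is descent;
   the last term of [s] carries [x]. *)
pose rep x s := T (enc s) /\ exists l t, s = pr e u :: rcons l (pr x t).
have rep0 x : rep x [:: pr e u; pr x 0].
  split; last by exists [::], 0.
  by apply/TP => -[|[|//]] _; rewrite /node !lk_enc /= !prE uP.
have rep_step x y s : slt (indexed set0 e) x y -> rep y s ->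
    exists t, rep x (rcons s (pr x t)).
  move=> [/PhiP [t Ht] ne] [Ts [l [t' sE]]]; exists t; split; last first.
    by exists (rcons l (pr y t')), t; rewrite sE.
  apply/TP => i; rewrite size_rcons ltnS leq_eqVlt => /orP [/eqP ->|iS]; last first.
    by rewrite node_rcons //; apply/(TP s).1.
  rewrite /node !lk_enc !nth_rcons sE /= size_rcons /= !ltnS leqnn ltnn eqxx !prE uP /=.
  rewrite nth_rcons ltnn eqxx /descends !prE Ht eqxx.
  by apply/eqP.
(* An element can have many representing nodes. The Kleene-Brouwer least one is canonical: if [x] is
   below [y], appending [x] to the node of [y] represents [x] and lies strictly lower. *)
have least x : exists s, rep x s /\ forall s', rep x s' -> s' = s \/ kb s s'.
  have [||s Rs sP] := bar_kb_least (s := [::]) (A := rep x) cl (wf_tree_bar cl wf).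
  - by move=> s [].
  - by exists [:: pr e u; pr x 0]; apply: rep0.
  - by exists s.
have [h hP] := choice least.
exists (fun x => enc (h x)) => [x Sx|x y xy].
  have [[Tx [l [t hE]]] _] := hP x; split; last by move/enc_inj; rewrite hE.
  by split=> //; right; rewrite !encK hE.
have [Ry _] := hP y; have [t Rx] := rep_step _ _ _ xy Ry.
have [[Tx _] hx] := hP x; have [Ty _] := Ry.
have lt : kb (h x) (h y).
  by have [<-|lt] := hx _ Rx; [|apply: kb_trans lt _]; apply: kb_rcons.
split; first by split=> //; right; rewrite !encK.
by move=> /enc_inj E; move: lt; rewrite E kb_irr.
Qed.

Theorem theorem2p3 (e : nat)
    (he : forall X : set nat, V e X = Vstar X) :
  [/\ forall X : set nat, X <_T HJ e X,
      forall X : set nat,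
        [/\ omega1_eq X set0 \/ omega1_lt set0 X,
            omega1_eq X set0 ->
              HJ e X ==_T jump X /\ ~ (hyperjump set0 <=_T HJ e X)
          & omega1_lt set0 X ->
              HJ e X ==_T hyperjump X /\
              hyperjump (hyperjump set0) <=_T HJ e X]
    & range (fun X : set nat => deg (HJ e X)) `&`
      [set d | [/\ degree d, deg_le (deg (hyperjump set0)) d
                 & deg_lt d (deg (hyperjump (hyperjump set0)))]] = set0].
Proof.
have XHJ X : X <=_T HJ e X by apply: turing_le_joinl.
have JHJ X : jump X <=_T HJ e X.
  apply: turing_le_trans (turing_le_joinr X (V e X)); rewrite he.
  exact: turing_le_joinl.
have eqJ X : omega1_eq X set0 -> HJ e X ==_T jump X.
  move=> eX; split; last exact: JHJ.
  apply: turing_join_le; first exact: turing_le_jump.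
  rewrite he; apply: turing_join_le; first exact: turing_le_refl.
  have -> : [set n | omega1_lt set0 X /\ hyperjump X n] = set0.
    by apply/seteqP; split=> n // [/(omega1_exclusive eX)].
  exact: set0_le.
have ltO X : omega1_lt set0 X -> HJ e X ==_T hyperjump X.
  move=> lX; have E : [set n | omega1_lt set0 X /\ hyperjump X n] = hyperjump X.
    by apply/seteqP; split=> n //= [].
  split.
    apply: turing_join_le; first exact: le_hyperjump.
    rewrite he /Vstar E; apply: turing_join_le; first exact: jump_le_hyperjump.
    exact: turing_le_refl.
  apply: turing_le_trans (turing_le_joinr X (V e X)); rewrite he /Vstar E.
  exact: turing_le_joinr.
have case1 X : omega1_eq X set0 -> ~ hyperjump set0 <=_T HJ e X.
  move=> eX OX; apply: (omega1_exclusive eX); apply: hyperjump_le_jump.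
  exact: turing_le_trans OX (eqJ X eX).1.
have case2 X : omega1_lt set0 X -> hyperjump (hyperjump set0) <=_T HJ e X.
  by move=> lX; apply: turing_le_trans (hyperjump_hyperjump_le lX) (ltO X lX).2.
have dich := omega1_dichotomy.
split=> [X|X|].
- split=> // HX; apply: (@jump_not_le X); exact: turing_le_trans (JHJ X) HX.
- by split=> // [eX|lX]; split; [exact: eqJ|exact: case1|exact: ltO|exact: case2].
apply/seteqP; split=> // d [[X _ <-] [_ [A [B [[_ OA] [BH _] AB]]] [lt ne]]].
have OHJ : hyperjump set0 <=_T HJ e X.
  exact: turing_le_trans OA (turing_le_trans AB BH).
(* The first case is excluded because O reduces to [HJ e X]; in the second, reductions in both
   directions make the two degrees equal, against strictness. *)
have [/case1 //|lX] := dich X; apply: ne.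
have {lt} [A' [B' [[_ HA'] [B'H _] AB']]] := lt.
have HO : HJ e X <=_T hyperjump (hyperjump set0).
  exact: turing_le_trans HA' (turing_le_trans AB' B'H).
have OH := case2 X lX.
apply/seteqP; split=> Y [Y1 Y2]; split.
- exact: turing_le_trans Y1 HO.
- exact: turing_le_trans OH Y2.
- exact: turing_le_trans Y1 OH.
- exact: turing_le_trans HO Y2.
Qed.
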